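(* Let $q\ge 4$ and let $H_1$ be a hyperplane of $\mathrm{PG}(U_1)$ with $|H_1\cap\mathcal O_1|=q^2-q+1$. Then $H_1\cap\mathcal O_1$ is a $(6,4)$-set of $H_1\cong\mathrm{PG}(6,q)$.
   Context: $q$ is a prime power. Let $U_1\subset\mathbb F_{q^3}^8$ be the set of vectors $(a,b^{q^2},b^{q},c,b,c^{q},c^{q^2},d)$ with $a,d\in\mathbb F_q$, $b,c\in\mathbb F_{q^3}$; it is an $8$-dimensional $\mathbb F_q$-vector space, so $\mathrm{PG}(U_1)\cong\mathrm{PG}(7,q)$. For $(a,b,c,d)\ne 0$ let $P(a,b,c,d)$ be the point of $\mathrm{PG}(U_1)$ spanned by this vector. Let $\mathcal O_1=\{P(1,t,t^{q^2+q},t^{q^2+q+1}) : t\in\mathbb F_{q^3}\}\cup\{P(0,0,0,1)\}$. For integers $r,s$, an $(r,s)$-set of $\mathrm{PG}(n,q)$ is a set $\mathcal X$ of points such that: (i) every $s$-dimensional projective subspace contains at most $r$ points of $\mathcal X$; (ii) $\mathcal X$ spans $\mathrm{PG}(n,q)$; (iii) some $(s+1)$-dimensional projective subspace contains $r+2$ points of $\mathcal X$. *)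

(* Defs.v *)
From HB Require Import structures.
From mathcomp Require Import all_boot all_order all_algebra all_field.
Unset Strict Implicit. Unset Printing Implicit Defensive.
Import GRing.Theory.
Local Open Scope ring_scope.

(* Setting: F is a finite field of order q^3 (so F = F_{q^3});
   Fq = { x in F | x^q = x } is its subfield of order q.
   Vectors live in F^8 = 'rV[F]_8; all linear algebra is over Fq. *)

Section Defs.
Variables (F : finFieldType) (q : nat).

Definition Fq : {set F} := [set x : F | x ^+ q == x].

Definition vecU (a b c d : F) : 'rV[F]_8 :=
  \row_(i < 8) nth 0 [:: a; b ^+ (q ^ 2); b ^+ q; c; b; c ^+ q; c ^+ (q ^ 2); d] i.

Definition U1 : {set 'rV[F]_8} :=
  [set x : 'rV[F]_8 | [exists a : F, exists b : F, exists c : F, exists d : F,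
     [&& a \in Fq, d \in Fq & x == vecU a b c d]]].

Definition subspace (W : {set 'rV[F]_8}) : Prop :=
  [/\ W \subset U1, (0 : 'rV[F]_8) \in W,
      (forall x y, x \in W -> y \in W -> x + y \in W) &
      (forall k x, k \in Fq -> x \in W -> k *: x \in W)].

(* W is a projective subspace of PG(U_1) of projective dimension s
   (i.e. an Fq-subspace of vector dimension s+1, of size q^(s+1)) *)
Definition proj_subspace (W : {set 'rV[F]_8}) (s : nat) : Prop :=
  subspace W /\ #|W| = (q ^ s.+1)%N.

Definition span (A : {set 'rV[F]_8}) : {set 'rV[F]_8} :=
  \bigcap_(W : {set 'rV[F]_8} | [&& W \subset U1, (0 : 'rV[F]_8) \in W,
      [forall x, forall y, (x \in W) ==> (y \in W) ==> (x + y \in W)],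
      [forall k, forall x, (k \in Fq) ==> (x \in W) ==> (k *: x \in W)]
      & A \subset W]) W.

Definition Pt (a b c d : F) : {set 'rV[F]_8} :=
  [set k *: vecU a b c d | k in Fq].

Definition O1 : {set {set 'rV[F]_8}} :=
  [set Pt 1 t (t ^+ (q ^ 2 + q)) (t ^+ (q ^ 2 + q + 1)) | t : F]
  :|: [set Pt 0 0 0 1].

Definition pts_in (X : {set {set 'rV[F]_8}}) (S : {set 'rV[F]_8}) :=
  [set P in X | P \subset S].

Definition rs_set_of (H : {set 'rV[F]_8}) (X : {set {set 'rV[F]_8}})
    (r s : nat) : Prop :=
  [/\ (forall S, proj_subspace S s -> S \subset H -> (#|pts_in X S| <= r)%N),
      span (\bigcup_(P in X) P) = H &
      exists S, [/\ proj_subspace S s.+1, S \subset H &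
                   (r.+2 <= #|pts_in X S|)%N]].

End Defs.

(* Main.v *)
(* The standard dot product of F^8 makes U1 self-dual over Fq, so a hyperplane H is the kernel of a functional h in U1, and h evaluated on O1 is the trilinear form tri of h at (t, t^q, t^(q^2)). Fixing one of the three arguments leaves a bilinear form whose determinant, pivot, is quadratic in that argument. If pivot has a root in F or at infinity, h is equivalent to N(t) + k or to a trace form, and divisibility excludes q^2 - q + 1 zeros.

Otherwise pivot has a root theta in F_{q^6} outside F. In the coordinates w_j = (t - theta)^(q^j), a functional reads sum_j b^(q^j) w_j w_(j+1) w_(j+2) + a w_0 w_2 w_4 + a^q w_1 w_3 w_5, and for h the coefficient b vanishes. With u = w_0 / w_3 the points of H are those with u^(q^2 - q + 1) = c: these are the rational points of a sextic del Pezzo surface xyz = c, and functionals are combinations of 1, x, y, z, xy, yz, zx, where x = u, y = u^(-q), z = u^(q^2).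

(i) The resultant in y of two functionals is a sextic in u; its leading coefficient is a product of two conjugates of b b'^q - b^q b', so it vanishes only if the functionals are proportional modulo h. Hence two independent functionals have at most six common zeros.
(ii) A functional restricted to H is a polynomial in u whose degree is too small to vanish everywhere.
(iii) For q >= 5, the pencil of functionals through five points has a member with three more zeros. For q = 4, functionals invariant under the involution u -> u0^2 / u vanish on pairs, and a Hamming bound for their values on the six pairs gives one that vanishes on four pairs. *)

Require Import Defs.
From HB Require Import structures.
From mathcomp Require Import all_boot all_order all_algebra all_field.
From mathcomp Require Import ring zify.

Set Implicit Arguments.
Unset Strict Implicit.
Unset Printing Implicit Defensive.
Import GRing.Theory.
Local Open Scope ring_scope.

(** * Counting by fibres, transversals and polynomial roots *)

Lemma leq_card_fibers (T : finType) (W : eqType) (A : {set T}) (g : T -> W)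
    (s : seq W) (m : nat) :
  (forall x, x \in A -> g x \in s) ->
  (forall w, #|[set x in A | g x == w]| <= m)%N -> (#|A| <= size s * m)%N.
Proof.
elim: s A => [|w s IHs] A gs lem.
  by rewrite leqn0 cards_eq0; apply/set0Pn => -[x /gs].
rewrite mulSn -(cardsID [set x | g x == w] A); apply: leq_add.
  by apply: leq_trans (lem w); apply/subset_leq_card/subsetP => x; rewrite !inE.
apply: IHs => [x | w'].
  by rewrite !inE => /andP[gxw /gs]; rewrite inE (negPf gxw).
by apply: leq_trans (lem w'); apply/subset_leq_card/subsetP => x; rewrite !inE => /andP[/andP[_ ->]].
Qed.

(** Translating a nonempty fibre by one of its elements embeds it in the kernel of [g]. With [s] a
    list that covers the values, this replaces rank-nullity in the counts below. *)
Lemma leq_card_additive (V : finZmodType) (W : zmodType) (A : {set V})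
    (g : V -> W) (s : seq W) :
  (forall x y, x \in A -> y \in A -> x - y \in A) ->
  (forall x y, x \in A -> y \in A -> g (x - y) = g x - g y) ->
  (forall x, x \in A -> g x \in s) ->
  (#|A| <= size s * #|[set x in A | g x == 0%R]|)%N.
Proof.
move=> AB gB gs; apply: leq_card_fibers gs _ => w.
have [->|[x]] := set_0Vmem [set x in A | g x == w]; first by rewrite cards0.
rewrite inE => /andP[xA /eqP gx].
rewrite -(card_imset _ (addIr (- x))); apply/subset_leq_card/subsetP => z /imsetP[y].
by rewrite !inE => /andP[yA /eqP gy] ->; rewrite AB // gB // gx gy subrr /=.
Qed.

Lemma dvdn_card_fibers (T : finType) (W : eqType) (A : {set T}) (g : T -> W) k :
  (forall x, x \in A -> #|[set y in A | g y == g x]| = k) -> (k %| #|A|)%N.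
Proof.
move=> gk; rewrite (card_uniform_partition (n := k) _ (preim_partitionP g A)).
  exact: dvdn_mull.
move=> _ /imsetP[x xA ->]; rewrite -(gk x xA); apply: eq_card => y.
by rewrite !inE eq_sym.
Qed.

Lemma pigeonhole3 (T U : finType) (A : {set T}) (B : {set U}) (g : T -> U) :
  (forall x, x \in A -> g x \in B) -> (2 * #|B| < #|A|)%N ->
  exists u, (3 <= #|[set x in A | g x == u]|)%N.
Proof.
move=> gB lt; apply/existsP; apply: contraLR lt => /existsPn le2.
rewrite -leqNgt mulnC [#|B|]cardE; apply: (leq_card_fibers (g := g)) => [x xA | u].
  by rewrite mem_enum gB.
by have := le2 u; rewrite -ltnNge ltnS.
Qed.

Lemma card_option_set (T : finType) (P : pred (option T)) :
  #|[set o | P o]| = (P None + #|[set t | P (Some t)]|)%N.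
Proof.
have inj : injective (@Some T) by move=> x y [].
rewrite (cardsD1 None) inE -(card_imset _ inj); congr (_ + _)%N.
apply: eq_card => -[t|]; rewrite !inE /=; last by apply/esym/imsetP => -[].
by rewrite (mem_imset _ _ inj) inE.
Qed.

Lemma notin_leq (T : finType) (A B : {set T}) : (#|B| < #|A|)%N ->
  exists2 x, x \in A & x \notin B.
Proof.
move=> lt; have /subsetPn[x xA xB] : ~~ (A \subset B).
  by apply: contraL lt => /subset_leq_card; rewrite -leqNgt.
by exists x.
Qed.

Lemma subset_of_card (T : finType) (A : {set T}) k : (k <= #|A|)%N ->
  exists2 B : {set T}, B \subset A & #|B| = k.
Proof.
move=> kA; exists [set x in take k (enum A)].
  by apply/subsetP => x; rewrite inE => /mem_take; rewrite mem_enum.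
rewrite cardsE; have /card_uniqP-> := take_uniq k (enum_uniq A).
by rewrite size_takel // -cardE.
Qed.

(** Induction on [D]: without one pair [x], [f x] the set is still stable under [f] and free of
    fixed points. *)
Lemma involution_transversal (T : finType) (D : {set T}) (f : T -> T) :
  (forall x, x \in D -> f x \in D) -> (forall x, x \in D -> f (f x) = x) ->
  (forall x, x \in D -> f x != x) ->
  exists2 R : {set T}, R \subset D & (#|D| = 2 * #|R|)%N /\ [disjoint R & f @: R].
Proof.
have [n] := ubnP #|D|; elim: n D => // n IHn D Dn fD fK fn.
have [->|[x xD]] := set_0Vmem D.
  exists set0; rewrite ?sub0set // !cards0; split=> //.
  by rewrite -setI_eq0 set0I.
have fxD := fD x xD; have fxx := fn x xD.
pose D' := D :\ x :\ f x.
have mD' y : (y \in D') = [&& y != f x, y != x & y \in D] by rewrite !inE.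
have cD : #|D| = #|D'|.+2.
  by rewrite (cardsD1 x D) xD (cardsD1 (f x) (D :\ x)) !inE fxx fxD.
have [||||R RD [cR dR]] := IHn D'.
- by move: Dn; rewrite cD ltnS => /ltnW.
- move=> y; rewrite !mD' => /and3P[yfx yx yD]; rewrite fD // andbT.
  apply/andP; split; first by apply: contra_neq yx => e; rewrite -(fK y) // e fK.
  by apply: contra_neq yfx => e; rewrite -(fK y) // e.
- by move=> y; rewrite mD' => /and3P[_ _]; apply: fK.
- by move=> y; rewrite mD' => /and3P[_ _]; apply: fn.
have RD0 y : y \in R -> [&& y != f x, y != x & y \in D].
  by move/(subsetP RD); rewrite mD'.
have xR : x \notin R by apply/negP => /RD0; rewrite eqxx andbF.
exists (x |: R).
  by rewrite subUset sub1set xD; apply/subsetP => y /RD0/and3P[].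
split; first by rewrite cD cardsU1 xR cR add1n mulnS.
rewrite disjoint_subset; apply/subsetP => y /setU1P[->|yR]; rewrite inE.
  apply/imsetP => -[z /setU1P[->|zR] e]; first by rewrite -e eqxx in fxx.
  by have /and3P[zfx _ zD] := RD0 z zR; rewrite e fK ?eqxx in zfx.
apply/imsetP => -[z /setU1P[->|zR] e].
  by have /and3P[] := RD0 y yR; rewrite e eqxx.
move: dR; rewrite disjoint_subset => /subsetP/(_ y yR); rewrite inE => /imsetP[].
by exists z.
Qed.

(** The left side has degree at most 5, so the difference of the sides, with coefficients [r], has
    leading coefficient [n3 * k3]. This is the shape of the resultant in [b_minor_eq0]. *)
Lemma sextic_roots (L : fieldType) (c m0 m1 m2 n0 n1 n2 n3 k0 k1 k2 k3 : L) (s : seq L) :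
  n3 * k3 != 0 -> uniq s ->
  (forall x, x \in s -> c * x * (m0 + m1 * x + m2 * x ^+ 2) ^+ 2 =
     (n0 + n1 * x + n2 * x ^+ 2 + n3 * x ^+ 3)
     * (k0 + k1 * x + k2 * x ^+ 2 + k3 * x ^+ 3)) ->
  (size s <= 6)%N.
Proof.
move=> nk us eqs.
pose r := [:: n0 * k0; n0 * k1 + n1 * k0 - c * m0 ^+ 2;
  n0 * k2 + n1 * k1 + n2 * k0 - c * (2%:R * m0 * m1);
  n0 * k3 + n1 * k2 + n2 * k1 + n3 * k0 - c * (m1 ^+ 2 + 2%:R * m0 * m2);
  n1 * k3 + n2 * k2 + n3 * k1 - c * (2%:R * m1 * m2);
  n2 * k3 + n3 * k2 - c * m2 ^+ 2; n3 * k3].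
have r0 : Poly r != 0.
  by apply: contra_neq nk => /(congr1 (fun p : {poly L} => p`_6)); rewrite coef_Poly coef0.
have rs : all (root (Poly r)) s.
  apply/allP => x xs; rewrite rootE horner_Poly /=; apply/eqP.
  transitivity ((n0 + n1 * x + n2 * x ^+ 2 + n3 * x ^+ 3)
     * (k0 + k1 * x + k2 * x ^+ 2 + k3 * x ^+ 3)
     - c * x * (m0 + m1 * x + m2 * x ^+ 2) ^+ 2); first by ring.
  by rewrite eqs // subrr.
by have := leq_trans (max_poly_roots r0 rs us) (size_Poly r).
Qed.

(** * The Frobenius map and the subfield of order q *)

Section FiniteField.
Variables (F : finFieldType) (q : nat).
Hypothesis cardF : #|F| = (q ^ 3)%N.
Hypothesis q_ge4 : (4 <= q)%N.

Local Notation Fq := (Fq F q).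
Local Notation vecU := (vecU F q).
Local Notation U1 := (U1 F q).
Local Notation subspace := (subspace F q).

Lemma q_gt0 : (0 < q)%N. Proof. by lia. Qed.
Hint Resolve q_gt0 : core.

(** [q ^ 3] is a power of the characteristic, hence so is [q]; this makes the [q]-power map
    additive. *)
Lemma q_nat : [pchar F].-nat q.
Proof.
have [p p_pr pF] := finPcharP F.
have := card_pprimeChar pF; rewrite cardF => q3.
rewrite (eq_pnat _ (pcharf_eq pF)).
have: p.-nat (q ^ 3)%N by rewrite q3 pnatX pnat_id.
by rewrite pnatX orbF.
Qed.

Lemma frobD (x y : F) : (x + y) ^+ q = x ^+ q + y ^+ q.
Proof. exact: exprDn_pchar q_nat. Qed.

Lemma frobN (x : F) : (- x) ^+ q = - x ^+ q.
Proof. exact: exprNn_pchar q_nat. Qed.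

Lemma frob0 : 0 ^+ q = 0 :> F.
Proof. by rewrite expr0n gtn_eqF. Qed.

Lemma frobB (x y : F) : (x - y) ^+ q = x ^+ q - y ^+ q.
Proof. by rewrite frobD frobN. Qed.

Lemma expr_sqr (K : pzSemiRingType) (x : K) : x ^+ (q ^ 2) = x ^+ q ^+ q.
Proof. by rewrite -exprM mulnn. Qed.

Lemma frob3 (x : F) : x ^+ q ^+ q ^+ q = x.
Proof. by rewrite -!exprM mulnn -expnS -cardF expf_card. Qed.

Lemma in_Fq (x : F) : (x \in Fq) = (x ^+ q == x).
Proof. by rewrite inE. Qed.

Lemma Fq0 : 0 \in Fq. Proof. by rewrite in_Fq frob0. Qed.
Lemma Fq1 : 1 \in Fq. Proof. by rewrite in_Fq expr1n. Qed.
Lemma FqD x y : x \in Fq -> y \in Fq -> x + y \in Fq.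
Proof. by rewrite !in_Fq frobD => /eqP-> /eqP->. Qed.
Lemma FqN x : x \in Fq -> - x \in Fq.
Proof. by rewrite !in_Fq frobN => /eqP->. Qed.
Lemma FqM x y : x \in Fq -> y \in Fq -> x * y \in Fq.
Proof. by rewrite !in_Fq exprMn => /eqP-> /eqP->. Qed.
Lemma FqV x : x \in Fq -> x^-1 \in Fq.
Proof. by rewrite !in_Fq exprVn => /eqP->. Qed.

(* The kernel of the trace has at most [q ^ 2] elements and its image lies in [Fq]. *)
Lemma card_Fq : #|Fq| = q.
Proof.
apply/eqP; rewrite eqn_leq; apply/andP; split.
  have p0 : 'X^q - 'X != 0 :> {poly F}.
    by rewrite -size_poly_eq0 size_polyDl ?size_polyN ?size_polyX ?size_polyXn //; lia.
  have := max_poly_roots p0 _ (enum_uniq Fq).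
  rewrite size_polyDl ?size_polyN ?size_polyX ?size_polyXn; last by lia.
  rewrite -cardE ltnS => -> //; apply/allP => x; rewrite mem_enum in_Fq => /eqP xq.
  by rewrite rootE !hornerE xq subrr.
pose T (x : F) := x + x ^+ q + x ^+ q ^+ q.
have: (#|[set: F]| <= size (enum Fq) * #|[set x in [set: F] | T x == 0%R]|)%N.
  apply: leq_card_additive => [|x y _ _|x _]; first by move=> *; rewrite inE.
    by rewrite /T !frobB; ring.
  by rewrite mem_enum in_Fq /T !frobD frob3; apply/eqP; ring.
rewrite cardsT cardF -cardE.
have: (#|[set x in [set: F] | T x == 0%R]| <= q ^ 2)%N; last first.
  move=> le2 /leq_trans/(_ (leq_mul (leqnn _) le2)).
  by rewrite expnS leq_pmul2r // expn_gt0 q_gt0.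
have sz : size ('X + 'X^q + 'X^(q ^ 2) : {poly F}) = (q ^ 2).+1.
  rewrite addrC size_polyDl size_polyXn //.
  apply: leq_ltn_trans (size_polyD _ _) _; rewrite size_polyX size_polyXn.
  by rewrite gtn_max; nia.
have p0 : 'X + 'X^q + 'X^(q ^ 2) != 0 :> {poly F} by rewrite -size_poly_eq0 sz.
have := max_poly_roots p0 _ (enum_uniq [set x in [set: F] | T x == 0%R]).
rewrite sz -cardE ltnS => -> //; apply/allP => x; rewrite mem_enum !inE /=.
by rewrite rootE !hornerE expr_sqr.
Qed.

(** * Coordinates and the self-dual pairing on [U1] *)

Definition co (K : Type) (v : 'rV[K]_8) (i : nat) : K := v ord0 (inord i).

Lemma co_vecU a b c d i : (i < 8)%N ->
  co (vecU a b c d) i =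
  nth 0 [:: a; b ^+ q ^+ q; b ^+ q; c; b; c ^+ q; c ^+ q ^+ q; d] i.
Proof. by move=> i8; rewrite /co mxE inordK // !expr_sqr. Qed.

Lemma co_inj (K : Type) (v w : 'rV[K]_8) :
  (forall i, (i < 8)%N -> co v i = co w i) -> v = w.
Proof.
move=> vw; apply/rowP => i; have := vw i (ltn_ord i).
by rewrite /co !inord_val.
Qed.

Definition dot (phi v : 'rV[F]_8) : F := \sum_i phi ord0 i * v ord0 i.

Lemma dotE phi v : dot phi v =
  co phi 0 * co v 0 + co phi 1 * co v 1 + co phi 2 * co v 2 + co phi 3 * co v 3
  + co phi 4 * co v 4 + co phi 5 * co v 5 + co phi 6 * co v 6 + co phi 7 * co v 7.
Proof.
rewrite /dot (eq_bigr (fun i : 'I_8 => co phi i * co v i)); last first.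
  by move=> i _; rewrite /co inord_val.
by rewrite !big_ord_recr big_ord0 /= add0r.
Qed.

Lemma dotBl phi psi v : dot (phi - psi) v = dot phi v - dot psi v.
Proof. by rewrite /dot -sumrB; apply: eq_bigr => i _; rewrite !mxE mulrBl. Qed.
Lemma dotDr phi v w : dot phi (v + w) = dot phi v + dot phi w.
Proof. by rewrite /dot -big_split; apply: eq_bigr => i _; rewrite !mxE mulrDr. Qed.
Lemma dotZl k phi v : dot (k *: phi) v = k * dot phi v.
Proof. by rewrite /dot mulr_sumr; apply: eq_bigr => i _; rewrite !mxE mulrA. Qed.
Lemma dotZr k phi v : dot phi (k *: v) = k * dot phi v.
Proof. by rewrite /dot mulr_sumr; apply: eq_bigr => i _; rewrite !mxE mulrCA. Qed.
Lemma dotBr phi v w : dot phi (v - w) = dot phi v - dot phi w.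
Proof. by rewrite dotDr -scaleN1r dotZr mulN1r. Qed.
Lemma dot0r phi : dot phi 0 = 0.
Proof. by rewrite -[0](scale0r (0 : 'rV_8)) dotZr mul0r. Qed.

Lemma coD (v w : 'rV[F]_8) i : co (v + w) i = co v i + co w i.
Proof. by rewrite /co mxE. Qed.
Lemma coZ k (v : 'rV[F]_8) i : co (k *: v) i = k * co v i.
Proof. by rewrite /co mxE. Qed.

Lemma U1P v : reflect (exists a b c d, [/\ a \in Fq, d \in Fq & v = vecU a b c d])
  (v \in U1).
Proof.
rewrite inE; apply: (iffP existsP) => [[a /existsP[b /existsP[c /existsP[d]]]]|].
  by case/and3P=> aq dq /eqP->; exists a, b, c, d.
case=> a [b [c [d [aq dq ->]]]]; exists a; apply/existsP; exists b.
by apply/existsP; exists c; apply/existsP; exists d; rewrite aq dq /=.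
Qed.

(** Written in three bits, the indices are rotated by the Frobenius map: its cycles are 4, 2, 1 and
    3, 5, 6, and it fixes 0 and 7. *)
Lemma U1_frob v : v \in U1 ->
  [/\ co v 0 ^+ q = co v 0, co v 4 ^+ q = co v 2, co v 2 ^+ q = co v 1
    & co v 1 ^+ q = co v 4] /\
  [/\ co v 3 ^+ q = co v 5, co v 5 ^+ q = co v 6, co v 6 ^+ q = co v 3
    & co v 7 ^+ q = co v 7].
Proof.
case/U1P=> a [b [c [d [aq dq ->]]]]; move: aq dq; rewrite !in_Fq => /eqP aq /eqP dq.
by rewrite !co_vecU //= !frob3.
Qed.

Lemma frob_U1 v :
  co v 0 ^+ q = co v 0 -> co v 4 ^+ q = co v 2 -> co v 2 ^+ q = co v 1 ->
  co v 3 ^+ q = co v 5 -> co v 5 ^+ q = co v 6 -> co v 7 ^+ q = co v 7 ->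
  v \in U1.
Proof.
move=> v0 v4 v2 v3 v5 v7; apply/U1P; exists (co v 0), (co v 4), (co v 3), (co v 7).
rewrite !in_Fq v0 v7 !eqxx; split=> //; apply: co_inj => i i8.
rewrite co_vecU // v4 v2 v3 v5.
by do 8! [case: i i8 => [//|i i8]].
Qed.

Lemma vecU_in a b c d : a \in Fq -> d \in Fq -> vecU a b c d \in U1.
Proof. by move=> aq dq; apply/U1P; exists a, b, c, d. Qed.

Lemma U1D v w : v \in U1 -> w \in U1 -> v + w \in U1.
Proof.
move=> /U1_frob[[v0 v4 v2 v1] [v3 v5 v6 v7]] /U1_frob[[w0 w4 w2 w1] [w3 w5 w6 w7]].
by apply: frob_U1; rewrite !coD frobD ?(v0, v4, v2, v3, v5, v7) ?(w0, w4, w2, w3, w5, w7).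
Qed.

Lemma U1Z k v : k \in Fq -> v \in U1 -> k *: v \in U1.
Proof.
rewrite in_Fq => /eqP kq /U1_frob[[v0 v4 v2 v1] [v3 v5 v6 v7]].
by apply: frob_U1; rewrite !coZ exprMn kq ?(v0, v4, v2, v3, v5, v7).
Qed.

Lemma U1_0 : 0 \in U1.
Proof. by apply: frob_U1; rewrite /co !mxE frob0. Qed.

Lemma U1B v w : v \in U1 -> w \in U1 -> v - w \in U1.
Proof. by move=> vU wU; rewrite -scaleN1r U1D ?U1Z ?FqN ?Fq1. Qed.

Lemma U1_subspace : subspace U1.
Proof.
by split; [exact: subxx | exact: U1_0 | move=> *; exact: U1D | move=> *; exact: U1Z].
Qed.

Lemma card_U1 : #|U1| = (q ^ 8)%N.
Proof.
pose f (z : F * F * (F * F)) := vecU z.1.1 z.2.1 z.2.2 z.1.2.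
have -> : U1 = f @: setX (setX Fq Fq) setT.
  apply/setP => v; apply/U1P/imsetP => [[a [b [c [d [aq dq ->]]]]]|].
    by exists ((a, d), (b, c)); rewrite ?inE /= -?in_Fq ?aq ?dq.
  case=> -[[a d] [b c]]; rewrite !inE /= andbT => /andP[aq dq ->].
  by exists a, b, c, d; rewrite !in_Fq.
rewrite card_imset => [|[[a d] [b c]] [[a' d'] [b' c']] /= vv].
  by rewrite !cardsX cardsT card_prod card_Fq cardF -!expnD -[(q * q)%N]/((q ^ 2)%N) -expnD.
have ck i : co (vecU a b c d) i = co (vecU a' b' c' d') i by rewrite [vecU _ _ _ _]vv.
have := (ck 0, ck 3, ck 4, ck 7); rewrite !co_vecU //=.
by case=> [[[-> ->] ->] ->].
Qed.

(** The Frobenius map permutes the eight products of coordinates, so their sum is fixed. *)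
Lemma dot_Fq v w : v \in U1 -> w \in U1 -> dot v w \in Fq.
Proof.
move=> /U1_frob[[v0 v4 v2 v1] [v3 v5 v6 v7]] /U1_frob[[w0 w4 w2 w1] [w3 w5 w6 w7]].
rewrite in_Fq dotE !frobD !exprMn v0 v4 v2 v1 v3 v5 v6 v7 w0 w4 w2 w1 w3 w5 w6 w7.
by apply/eqP; ring.
Qed.

(** * Subspaces, annihilators and their sizes *)

Definition addline (W : {set 'rV[F]_8}) (x : 'rV[F]_8) : {set 'rV[F]_8} :=
  [set z.1 + z.2 *: x | z : 'rV[F]_8 * F in setX W Fq].

Lemma subspaceB W x y : subspace W -> x \in W -> y \in W -> x - y \in W.
Proof.
by case=> _ _ WD WZ xW yW; rewrite -scaleN1r WD ?WZ ?FqN ?Fq1.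
Qed.

Lemma addline_subspace W x : subspace W -> x \in U1 -> subspace (addline W x).
Proof.
case=> /subsetP WU W0 WD WZ xU; split.
- apply/subsetP => _ /imsetP[[w k] /setXP[/= wW kq] ->].
  by apply: U1D; [exact: WU | exact: U1Z].
- by apply/imsetP; exists (0, 0); rewrite ?scale0r ?addr0 // inE W0 Fq0.
- move=> _ _ /imsetP[[w k] /setXP[/= wW kq] ->] /imsetP[[w' k'] /setXP[/= wW' kq'] ->].
  apply/imsetP; exists (w + w', k + k'); first by rewrite inE /= WD ?FqD.
  by rewrite /= scalerDl addrACA.
move=> a _ aq /imsetP[[w k] /setXP[/= wW kq] ->].
apply/imsetP; exists (a *: w, a * k); first by rewrite inE /= WZ ?FqM.
by rewrite /= scalerDr scalerA.
Qed.

Lemma card_addline W x : subspace W -> x \notin W -> #|addline W x| = (#|W| * q)%N.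
Proof.
move=> sW xW; rewrite card_in_imset ?cardsX ?card_Fq //.
move=> [w k] [w' k'] /setXP[/= wW kq] /setXP[/= wW' kq'] eqw.
have ww : w' - w = (k - k') *: x.
  by rewrite scalerBl; apply/eqP; rewrite subr_eq addrAC -(addrC w) eqw addrK.
have [kk|kk] := eqVneq k k'.
  by move: ww; rewrite kk subrr scale0r => /eqP; rewrite subr_eq0 => /eqP->.
case/negP: xW; rewrite -[x]scale1r -(mulVf (x := k - k')) ?subr_eq0 // -scalerA -ww.
case: (sW) => _ _ _ WZ; apply: WZ; first by rewrite FqV ?FqD ?FqN.
exact: subspaceB.
Qed.

Lemma addline_sub (W W' : {set 'rV[F]_8}) x :
  subspace W' -> W \subset W' -> x \in W' -> addline W x \subset W'.
Proof.
case=> _ _ WD WZ /subsetP sWW xW; apply/subsetP => _ /imsetP[[w k] /setXP[/= wW kq] ->].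
by apply: WD; [exact: sWW | exact: WZ].
Qed.

Definition ann (A : {set 'rV[F]_8}) : {set 'rV[F]_8} :=
  [set phi in U1 | [forall v in A, dot phi v == 0]].

Lemma annP (A : {set 'rV[F]_8}) phi :
  reflect (phi \in U1 /\ forall v, v \in A -> dot phi v = 0) (phi \in ann A).
Proof.
rewrite [X in reflect _ X]in_set; apply: (iffP andP) => -[phiU phiA]; split=> //.
  by move=> v vA; apply/eqP; apply: (forall_inP phiA).
by apply/forall_inP => v /phiA/eqP.
Qed.

Lemma annB A x y : x \in ann A -> y \in ann A -> x - y \in ann A.
Proof.
move=> /annP[xU xA] /annP[yU yA]; apply/annP; split; first exact: U1B.
by move=> v vA; rewrite dotBl xA ?yA ?subr0.
Qed.

Lemma annS (A B : {set 'rV[F]_8}) : A \subset B -> ann B \subset ann A.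
Proof.
move=> /subsetP sAB; apply/subsetP => x /annP[xU xB]; apply/annP; split=> // v /sAB.
exact: xB.
Qed.

(** The added condition is the kernel of an additive map into [Fq], so it costs a factor of at most
    [q]. *)
Lemma leq_card_ann1 A x : x \in U1 -> (#|ann A| <= q * #|ann (x |: A)|)%N.
Proof.
move=> xU.
have -> : ann (x |: A) = [set phi in ann A | dot phi x == 0].
  apply/setP => phi; rewrite [RHS]in_set; apply/annP/andP => [[pU pA]|[/annP[pU pA] /eqP px]].
    split; last by rewrite pA // setU11.
    by apply/annP; split=> // v vA; rewrite pA // setU1r.
  by split=> // v /setU1P[->|/pA].
rewrite -[q in (q * _)%N]card_Fq [#|Fq|]cardE.
apply: (leq_card_additive (g := dot^~ x)) => [phi psi|phi psi _ _|phi /annP[pU _]].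
- exact: annB.
- exact: dotBl.
- by rewrite mem_enum dot_Fq.
Qed.

Lemma ann0 : ann set0 = U1.
Proof. by apply/setP => x; apply/annP/idP => [[] //|xU]; split=> // v; rewrite inE. Qed.

Lemma leq_card_ann (A : {set 'rV[F]_8}) :
  A \subset U1 -> (q ^ 8 <= q ^ #|A| * #|ann A|)%N.
Proof.
have [n] := ubnP #|A|; elim: n A => // n IHn A.
have [->|[x xA]] := set_0Vmem A; first by rewrite cards0 ann0 card_U1 mul1n.
have cA : #|A| = #|A :\ x|.+1 by rewrite (cardsD1 x A) xA.
rewrite cA ltnS => An AU; have xU := subsetP AU x xA.
apply: leq_trans (IHn _ An (subset_trans (subD1set A x) AU)) _.
rewrite expnSr -mulnA leq_mul2l; apply/orP; right.
by have := leq_card_ann1 (A :\ x) xU; rewrite setD1K.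
Qed.

(* Adjoining vectors one at a time, each step multiplies the cardinal by [q]. *)
Lemma subspace_gen W : subspace W ->
  exists k, #|W| = (q ^ k)%N /\
  exists A : {set 'rV[F]_8}, [/\ A \subset W, (#|A| <= k)%N & ann A \subset ann W].
Proof.
move=> sW; have [WU W0 WD WZ] := sW.
match goal with |- ?G => set goal := G end.
(* At stage [k] the chain has either exhausted [W] or reached [q ^ k] elements; at stage [#|W|] the
   second case is too large. *)
have step k : goal \/ exists W', [/\ subspace W', W' \subset W, #|W'| = (q ^ k)%N &
    exists A : {set 'rV[F]_8}, [/\ A \subset W, (#|A| <= k)%N & ann A \subset ann W']].
  elim: k => [|k [?|[W' [sW' W'W cW' [A [AW cA AW']]]]]]; [right | by left |].
    exists [set 0]; split; rewrite ?sub1set ?cards1 //.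
      split; [by rewrite sub1set U1_0 | exact: set11 | |].
        by move=> x y /set1P-> /set1P->; rewrite addr0 set11.
      by move=> a x _ /set1P->; rewrite scaler0 set11.
    exists set0; rewrite sub0set cards0; split=> //; apply/subsetP => x /annP[xU _].
    by apply/annP; split=> // v /set1P->; rewrite dot0r.
  have [eqW|neW] := eqVneq W' W.
    by left; exists k; rewrite -eqW; split=> //; exists A; rewrite eqW in AW' *.
  have /properP[_ [x xW xW']] : W' \proper W by rewrite properEneq neW.
  have xU := subsetP WU x xW.
  right; exists (addline W' x); split.
  - exact: addline_subspace.
  - exact: addline_sub.
  - by rewrite card_addline // cW' -expnSr.
  exists (x |: A); split; first by rewrite subUset sub1set xW.
    by rewrite cardsU cards1 (leq_trans (leq_subr _ _)).
  apply/subsetP => phi pA; have pA' : phi \in ann A.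
    by apply: subsetP pA; rewrite annS // subsetUr.
  have /annP[pU pW'] := subsetP AW' _ pA'; have /annP[_ px] := pA.
  apply/annP; split=> // _ /imsetP[[w a] /setXP[/= wW aq] ->].
  by rewrite dotDr dotZr pW' // px ?setU11 // mulr0 addr0.
case: (step #|W|) => // -[W' [_ W'W cW' _]].
by have := subset_leq_card W'W; rewrite cW' leqNgt ltn_expl //; lia.
Qed.

Lemma card_ann_subspace W k : subspace W -> (#|W| <= q ^ k)%N -> (k <= 8)%N ->
  (q ^ (8 - k) <= #|ann W|)%N.
Proof.
move=> sW; have [WU _ _ _] := sW.
have [j [-> [A [AW cA AnnA]]]] := subspace_gen sW.
rewrite leq_exp2l; last by lia.
move=> jk k8; have := leq_card_ann (subset_trans AW WU).
move=> le8; rewrite -(leq_pmul2l (m := (q ^ k)%N)) ?expn_gt0 ?q_gt0 //.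
rewrite -expnD subnKC // (leq_trans le8) // leq_mul ?subset_leq_card //.
by rewrite leq_exp2l; lia.
Qed.

(** * Functionals as trilinear forms on the points of [O1] *)

(* The index of a coefficient is the exponent of [(x, y, z)] read in binary; [s] homogenises. *)
Definition tri (K : pzRingType) (c : nat -> K) (s x y z : K) : K :=
  c 0%N * s ^+ 3 + s ^+ 2 * (c 1%N * z + c 2%N * y + c 4%N * x)
  + s * (c 3%N * y * z + c 5%N * x * z + c 6%N * x * y) + c 7%N * x * y * z.

Definition pt (o : option F) : 'rV[F]_8 :=
  if o is Some t then vecU 1 t (t ^+ (q ^ 2 + q)) (t ^+ (q ^ 2 + q + 1))
  else vecU 0 0 0 1.

(* [None] is the point at infinity, with homogeneous coordinates [(ps, px) = (0, 1)]. *)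
Definition ps (o : option F) : F := if o is Some _ then 1 else 0.
Definition px (o : option F) : F := if o is Some t then t else 1.

Lemma pt_in o : pt o \in U1.
Proof.
case: o => [t|] /=; rewrite vecU_in ?Fq1 ?Fq0 // in_Fq.
by rewrite !exprD expr1 !exprMn expr_sqr frob3; apply/eqP; ring.
Qed.

Lemma dot_pt phi o :
  dot phi (pt o) = tri (co phi) (ps o) (px o) (px o ^+ q) (px o ^+ q ^+ q).
Proof.
rewrite dotE /tri; case: o => [t|] /=; rewrite !co_vecU //=.
  by rewrite !exprD !expr1 !exprMn !expr_sqr !frob3; ring.
by rewrite !frob0 !expr1n expr0n /=; ring.
Qed.

Lemma dot_pt_None phi : dot phi (pt None) = co phi 7.
Proof. by rewrite dot_pt /tri /= !expr1n; ring. Qed.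

(** As a polynomial in t the functional has degree at most q^2 + q + 1, less than [#|F|], so it is
    the zero polynomial. The coefficients 0, 3, 4, 7 are read off at distinct exponents; the others
    are conjugates of these. *)
Lemma pt_nondeg phi : phi \in U1 -> (forall o, dot phi (pt o) = 0) -> phi = 0.
Proof.
move=> pU p0; have [[_ v4 v2 _] [v3 v5 _ _]] := U1_frob pU.
have Q4 : (4 * q <= q ^ 2)%N by rewrite -mulnn leq_mul2r q_ge4 orbT.
pose p : {poly F} := (co phi 0)%:P + co phi 1 *: 'X^(q ^ 2) + co phi 2 *: 'X^q
  + co phi 3 *: 'X^(q ^ 2 + q) + co phi 4 *: 'X^1 + co phi 5 *: 'X^(q ^ 2 + 1)
  + co phi 6 *: 'X^(q + 1) + co phi 7 *: 'X^(q ^ 2 + q + 1).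
have pz : p = 0.
  apply/eqP; apply: contraT => pn0.
  have rp : all (root p) (enum F).
    apply/allP => t _; have := p0 (Some t); rewrite dot_pt /tri /= => ft.
    apply/eqP; rewrite /p !hornerE !exprD expr_sqr -[RHS]ft; ring.
  have := max_poly_roots pn0 rp (enum_uniq F); rewrite -cardE cardF => lt1.
  have : (size p <= (q ^ 2 + q + 1).+1)%N.
    rewrite /p; do 7! [apply: leq_trans (size_polyD _ _) _; rewrite geq_max; apply/andP; split;
      last by apply: leq_trans (size_scale_leq _ _) _; rewrite size_polyXn; lia].
    by apply: leq_trans (size_polyC_leq1 _) _.
  move/(leq_trans lt1); rewrite expnS ltnS.
  by nia.
have pc i : p`_i = 0 by rewrite pz coef0.
have c0 : co phi 0 = 0.
  by rewrite -(pc 0%N) /p !coefE eqxx; do ![case: eqP => [?|_]; first lia];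
    rewrite ?mulr0 ?mulr1 ?add0r ?addr0.
have c4 : co phi 4 = 0.
  by rewrite -(pc 1%N) /p !coefE eqxx; do ![case: eqP => [?|_]; first lia];
    rewrite ?mulr0 ?mulr1 ?add0r ?addr0.
have c3 : co phi 3 = 0.
  by rewrite -(pc (q ^ 2 + q)%N) /p !coefE eqxx; do ![case: eqP => [?|_]; first lia];
    rewrite ?mulr0 ?mulr1 ?add0r ?addr0.
have c7 : co phi 7 = 0.
  by rewrite -(pc (q ^ 2 + q + 1)%N) /p !coefE eqxx; do ![case: eqP => [?|_]; first lia];
    rewrite ?mulr0 ?mulr1 ?add0r ?addr0.
apply: co_inj => i i8; rewrite [RHS]mxE.
move: v4 v2 v3 v5; rewrite c4 c3 frob0 => v2 v1 v5 v6.
rewrite -v2 -v5 frob0 in v1 v6.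
by do 8! [case: i i8 => [//|i i8]].
Qed.

(** * Fibres of the norm and of trace forms *)

Definition norm3 (x : F) : F := x * x ^+ q * x ^+ q ^+ q.

Lemma norm3M x y : norm3 (x * y) = norm3 x * norm3 y.
Proof. by rewrite /norm3 !exprMn; ring. Qed.

Lemma norm3_eq0 x : (norm3 x == 0) = (x == 0).
Proof. by rewrite !mulf_eq0 !expf_eq0 q_gt0 /= !orbb. Qed.

(* A nonempty fibre over [k != 0] has cardinal dividing [q ^ 3 - 1], while [q ^ 2 - q + 1] divides
   [q ^ 3 + 1]. *)
Lemma card_norm3_fiber k : #|[set t | norm3 t == k]| != (q ^ 2 - q + 1)%N.
Proof.
have Q4 : (4 * q <= q ^ 2)%N by rewrite -mulnn leq_mul2r q_ge4 orbT.
have [->|k0] := eqVneq k 0.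
  have -> : [set t | norm3 t == 0] = [set 0] by apply/setP => t; rewrite !inE norm3_eq0.
  by rewrite cards1; lia.
apply/eqP => ck; have [z] : exists z, z \in [set t | norm3 t == k].
  by apply/set0Pn; rewrite -cards_eq0 ck; lia.
rewrite inE => /eqP zk.
have z0 : z != 0 by rewrite -norm3_eq0 zk.
have := @dvdn_card_fibers F F [set~ 0] norm3 (q ^ 2 - q + 1).
rewrite cardsC1 cardF => dvd.
have {dvd} : (q ^ 2 - q + 1 %| (q ^ 3).-1)%N.
  apply: dvd => x; rewrite !inE => x0.
  rewrite -ck -(card_imset [set y in [set~ 0] | norm3 y == norm3 x] (mulfI (x := z / x) _)).
    apply: eq_card => y; rewrite inE; apply/imsetP/idP => [[t]|/eqP yk].
      rewrite !inE => /andP[_ /eqP tx] ->.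
      by rewrite norm3M tx -norm3M divfK // zk.
    have y0 : y != 0 by rewrite -norm3_eq0 yk.
    exists (y * (x / z)); last by field; rewrite z0 x0.
    rewrite !inE !mulf_neq0 ?invr_eq0 //= norm3M yk -zk -norm3M.
    by rewrite [z * _]mulrC divfK.
  by rewrite mulf_neq0 ?invr_eq0.
have n3 : (q ^ 3 + 1 = (q + 1) * (q ^ 2 - q + 1))%N by nia.
have q3 : (0 < q ^ 3)%N by rewrite expn_gt0 q_gt0.
have -> : ((q ^ 3).-1 = (q + 1) * (q ^ 2 - q + 1) - 2)%N by rewrite -n3; lia.
have n2 : (2 < q ^ 2 - q + 1)%N by lia.
rewrite dvdn_subr; last by apply: dvdn_mull.
  by move/dvdn_leq; lia.
by nia.
Qed.

(** Nonempty fibres of [T] are cosets of its kernel, so their size divides q^3, whereas the factor q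
    - 1 > 1 of q^2 - q is coprime to q. *)
Lemma card_trace_fiber (a b : F) :
  #|[set t | a + (b * t + b ^+ q * t ^+ q + b ^+ q ^+ q * t ^+ q ^+ q) == 0]|
    != (q ^ 2 - q)%N.
Proof.
pose T t := b * t + b ^+ q * t ^+ q + b ^+ q ^+ q * t ^+ q ^+ q.
have TB x y : T (x - y) = T x - T y by rewrite /T !frobB; ring.
have Q4 : (4 * q <= q ^ 2)%N by rewrite -mulnn leq_mul2r q_ge4 orbT.
apply/eqP => ck.
have [z] : exists z, z \in [set t | a + T t == 0].
  by apply/set0Pn; rewrite -cards_eq0 ck; lia.
rewrite inE addrC addr_eq0 => /eqP zk.
have : (q ^ 2 - q %| #|[set: F]|)%N.
  apply: (dvdn_card_fibers (g := T)) => x _.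
  rewrite -ck -(card_imset [set y in [set: F] | T y == T x] (addrI (z - x))).
  apply: eq_card => y; rewrite inE; apply/imsetP/idP => [[t]|/eqP yk].
    rewrite !inE => /eqP tx ->.
    have -> : z - x + t = z - (x - t) by ring.
    by rewrite -/(T _) !TB tx zk; apply/eqP; ring.
  exists (y - (z - x)); last by ring.
  move/eqP: yk; rewrite -/(T _) addrC addr_eq0 => /eqP yk.
  by rewrite !inE !TB yk zk; apply/eqP; ring.
rewrite cardsT cardF.
have -> : (q ^ 2 - q = q * (q - 1))%N by nia.
rewrite expnS dvdn_pmul2l // => dvd.
have : coprime (q - 1) (q ^ 2).
  rewrite coprimeXr // coprime_sym subn1.
  by have := coprimeSn q.-1; rewrite prednK.
by rewrite /coprime => /eqP; move/gcdn_idPl: dvd => ->; lia.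
Qed.

(** * Functionals whose pivot has a root in [F] or at infinity *)

Definition zeros (phi : 'rV[F]_8) : {set option F} := [set o | dot phi (pt o) == 0].

(* The determinant of the bilinear form in [y, z] obtained from [tri c] by fixing [x]. *)
Definition pivot (K : pzRingType) (c : nat -> K) (x : K) : K :=
  (c 0%N + c 4%N * x) * (c 3%N + c 7%N * x) - (c 2%N + c 6%N * x) * (c 1%N + c 5%N * x).

(** By hypothesis the coefficient of x^2 in [pivot] is zero. If [co phi 7] is zero, so are the
    coefficients 3, 5, 6: a trace form remains, and the point at infinity is one further zero.
    Otherwise the shift [t + e] turns the form into a multiple of a norm plus a constant. *)
Lemma zeros_pivot_infty phi : phi \in U1 ->
  co phi 4 * co phi 7 = co phi 5 * co phi 6 -> #|zeros phi| != (q ^ 2 - q + 1)%N.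
Proof.
move=> pU; have [[v0 v4 v2 v1] [v3 v5 v6 v7]] := U1_frob pU => lc.
have lc2 : co phi 2 * co phi 7 = co phi 6 * co phi 3.
  by have := congr1 (fun x => x ^+ q) lc; rewrite /= !exprMn v4 v7 v5 v6.
have lc1 : co phi 1 * co phi 7 = co phi 3 * co phi 5.
  by have := congr1 (fun x => x ^+ q) lc2; rewrite /= !exprMn v2 v7 v6 v3.
have Q4 : (4 * q <= q ^ 2)%N by rewrite -mulnn leq_mul2r q_ge4 orbT.
rewrite /zeros card_option_set dot_pt_None.
have -> : [set t | dot phi (pt (Some t)) == 0] = [set t |
    co phi 0 + co phi 1 * t ^+ q ^+ q + co phi 2 * t ^+ q + co phi 4 * t
   + co phi 3 * t ^+ q * t ^+ q ^+ q + co phi 5 * t * t ^+ q ^+ q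
   + co phi 6 * t * t ^+ q + co phi 7 * t * t ^+ q * t ^+ q ^+ q == 0].
  by apply/setP => t; rewrite !inE dot_pt /tri /=; congr (_ == _); ring.
have [d0|d0] := eqVneq (co phi 7) 0.
  have g0 : co phi 3 = 0.
    move/esym/eqP: lc; rewrite d0 mulr0 mulf_eq0 -v5 -v3 !expf_eq0 q_gt0 /= orbb.
    by move/eqP.
  have g5 : co phi 5 = 0 by rewrite -v3 g0 frob0.
  have g6 : co phi 6 = 0 by rewrite -v5 g5 frob0.
  have := card_trace_fiber (co phi 0) (co phi 4).
  rewrite v4 v2 d0 g0 g5 g6; set A := [set t | _]; set B := [set t | _].
  have -> : B = A by apply/setP => t; rewrite !inE; congr (_ == _); ring.
  by rewrite add1n addn1 eqSS.
pose e := co phi 3 / co phi 7.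
have e1 : e ^+ q = co phi 5 / co phi 7 by rewrite /e exprMn exprVn v3 v7.
have e2 : e ^+ q ^+ q = co phi 6 / co phi 7 by rewrite e1 exprMn exprVn v5 v7.
have := card_norm3_fiber (norm3 e - co phi 0 / co phi 7).
rewrite add0n -(card_imset _ (addIr (- e))); congr (_ != _); apply: eq_card => t.
rewrite inE; apply/imsetP/idP => [[x]|ft].
  rewrite inE /norm3 => /eqP xN ->; rewrite !frobB e2 e1.
  have -> : co phi 0 = co phi 7 * (e * e ^+ q * e ^+ q ^+ q - x * x ^+ q * x ^+ q ^+ q).
    by rewrite xN; field.
  rewrite e2 e1 /e -[co phi 1](mulfK d0) -[co phi 2](mulfK d0) -[co phi 4](mulfK d0).
  by rewrite lc lc2 lc1; apply/eqP; field.
exists (t + e); last by rewrite addrK.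
rewrite inE /norm3 !frobD e2 e1 /e -subr_eq0.
rewrite -[X in X == _](mulfK d0) mulf_eq0; apply/orP; left.
rewrite -(eqP ft) -[co phi 1](mulfK d0) -[co phi 2](mulfK d0) -[co phi 4](mulfK d0).
by rewrite lc lc2 lc1; apply/eqP; field.
Qed.

Definition mob (x : F) (o : option F) : option F :=
  if o is Some t then (if t == 0 then None else Some (x + t^-1)) else Some x.

Lemma mob_inj x : injective (mob x).
Proof.
have xV t : t != 0 -> x + t^-1 != x.
  by move=> t0; rewrite -subr_eq0 addrAC subrr add0r invr_eq0.
move=> [t|] [s|] //=; do ?case: eqP => [->|/eqP ?] //.
- by case=> /addrI/invr_inj->.
- by case=> /eqP; rewrite (negPf (xV _ _)).
- by case=> /esym/eqP; rewrite (negPf (xV _ _)).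
Qed.

(* The substitution [t := x + 1 / t] moves the root [x] of [pivot] to infinity. *)
Lemma zeros_pivot phi (x : F) : phi \in U1 -> pivot (co phi) x = 0 ->
  #|zeros phi| != (q ^ 2 - q + 1)%N.
Proof.
move=> pU; have [[v0 v4 v2 v1] [v3 v5 v6 v7]] := U1_frob pU => piv.
pose y : F := x ^+ q; pose z : F := x ^+ q ^+ q.
have zq : z ^+ q = x by rewrite /z frob3.
(* [d], [g], [b] and [co phi 7], with their conjugates, are the Taylor coefficients of the trilinear
   form at [(x, y, z)]; multiplication by [norm3 t] reverses their order. *)
pose g := co phi 4 + co phi 5 * z + co phi 6 * y + co phi 7 * y * z.
have gq : g ^+ q = co phi 2 + co phi 6 * x + co phi 3 * z + co phi 7 * z * x.
  by rewrite /g !frobD !exprMn v4 v5 v6 v7 zq.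
have gqq : g ^+ q ^+ q = co phi 1 + co phi 3 * y + co phi 5 * x + co phi 7 * x * y.
  by rewrite gq !frobD !exprMn v2 v6 v3 v7 zq.
pose b := co phi 3 + co phi 7 * x.
have bq : b ^+ q = co phi 5 + co phi 7 * y by rewrite /b frobD exprMn v3 v7.
have bqq : b ^+ q ^+ q = co phi 6 + co phi 7 * z by rewrite bq frobD exprMn v5 v7.
pose d := dot phi (pt (Some x)).
have dE : d = tri (co phi) 1 x y z by rewrite /d dot_pt.
have psiU : vecU (co phi 7) b g d \in U1.
  by rewrite vecU_in ?in_Fq ?v7 // -in_Fq dot_Fq ?pt_in.
have -> : #|zeros phi| = #|zeros (vecU (co phi 7) b g d)|.
  rewrite -(card_preimset _ (@mob_inj x)); apply: eq_card => o; rewrite !inE.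
  case: o => [t|]; rewrite /mob; last by rewrite dot_pt_None co_vecU.
  case: ifPn => [/eqP->|t0].
    by rewrite dot_pt_None dot_pt /tri !co_vecU //= !frob0; congr (_ == _); ring.
  have tq0 : t ^+ q != 0 by rewrite expf_neq0.
  have tqq0 : t ^+ q ^+ q != 0 by rewrite expf_neq0.
  have -> : dot phi (pt (Some (x + t^-1))) =
      dot (vecU (co phi 7) b g d) (pt (Some t)) / norm3 t.
    rewrite !dot_pt /norm3 /tri !co_vecU //= bqq bq gqq gq dE /tri !frobD !exprVn -/y -/z.
    by rewrite /b /g; field; rewrite t0 tq0 tqq0.
  by rewrite mulf_eq0 invr_eq0 norm3_eq0 (negPf t0) orbF.
apply: zeros_pivot_infty psiU _; rewrite !co_vecU //= gqq gq dE /tri.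
apply/eqP; rewrite -subr_eq0 -piv /pivot /b; apply/eqP; ring.
Qed.

Definition line (phi : 'rV[F]_8) : {set 'rV[F]_8} := [set k *: phi | k in Fq].

Lemma card_line phi : (#|line phi| <= q)%N.
Proof. by rewrite -[q in leqRHS]card_Fq leq_imset_card. Qed.

(** * Interpolation at the conjugates of theta in an extension field *)

Section Extension.
Variables (L : fieldType) (iota : {rmorphism F -> L}).

Lemma q_nat_ext : [pchar L].-nat q.
Proof. by rewrite (eq_pnat _ (fmorph_pchar iota)) q_nat. Qed.

Lemma frobDL (x y : L) : (x + y) ^+ q = x ^+ q + y ^+ q.
Proof. exact: exprDn_pchar q_nat_ext. Qed.
Lemma frobNL (x : L) : (- x) ^+ q = - x ^+ q.
Proof. exact: exprNn_pchar q_nat_ext. Qed.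
Lemma frobBL (x y : L) : (x - y) ^+ q = x ^+ q - y ^+ q.
Proof. by rewrite frobDL frobNL. Qed.

Lemma frob_injL : injective (fun x : L => x ^+ q).
Proof.
move=> x y /= /eqP; rewrite -subr_eq0 -frobBL expf_eq0 q_gt0 subr_eq0 /=.
by move/eqP.
Qed.

(** The polynomial X^(q^3) - X already splits over [F], so its roots in [L] come from [F]. *)
Lemma frob3_im (x : L) : x ^+ q ^+ q ^+ q = x -> exists t, x = iota t.
Proof.
rewrite -!exprM mulnn -expnS -cardF => xq.
have := congr1 (fun p => (map_poly iota p).[x]) (finField_genPoly F).
rewrite rmorphB rmorph_prod /= map_polyXn map_polyX !hornerE xq subrr horner_prod.
move/esym/eqP; rewrite prodf_seq_eq0 => /hasP[t _] /=.
rewrite map_polyXsubC !hornerE subr_eq0 => /eqP->; by exists t.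
Qed.

Lemma frob1_im (x : L) : x ^+ q = x -> exists2 k, k \in Fq & x = iota k.
Proof.
move=> xq; have [|k xk] := @frob3_im x; first by rewrite !xq.
by exists k; rewrite // in_Fq -(inj_eq (fmorph_inj iota)) rmorphXn /= -xk xq.
Qed.

Variables th0 th1 th2 th3 th4 th5 : L.
Hypothesis th0q : th0 ^+ q = th1.
Hypothesis th1q : th1 ^+ q = th2.
Hypothesis th2q : th2 ^+ q = th3.
Hypothesis th3q : th3 ^+ q = th4.
Hypothesis th4q : th4 ^+ q = th5.
Hypothesis th5q : th5 ^+ q = th0.
Hypothesis th30 : th3 != th0.

Definition ico (phi : 'rV[F]_8) (i : nat) : L := iota (co phi i).

Let thq := (th0q, th1q, th2q, th3q, th4q, th5q).
Let frobL := (frobDL, frobBL, frobNL, exprMn, exprVn, thq).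

(** The Frobenius map rotates the index bits of [ico phi], which amounts to rotating the three
    arguments. *)
Lemma tri_frob phi (x y z : L) : phi \in U1 ->
  tri (ico phi) 1 x y z ^+ q = tri (ico phi) 1 (z ^+ q) (x ^+ q) (y ^+ q).
Proof.
move/U1_frob=> [[v0 v4 v2 v1] [v3 v5 v6 v7]].
by rewrite /tri /ico !frobL !expr1n -!rmorphXn /= v0 v4 v2 v1 v3 v5 v6 v7; ring.
Qed.

Definition disc : L := (th3 - th0) * (th4 - th1) * (th5 - th2).

(** The third factor is sent to [th0 - th3], whence the sign; the alternating signs of the [b_j]
    below absorb it, so that they are conjugate. *)
Lemma disc_frob : disc ^+ q = - disc.
Proof. by rewrite /disc !frobL; ring. Qed.

Lemma disc_neq0 : disc != 0.
Proof.
have th41 : th4 != th1 by rewrite -th3q -th0q (inj_eq frob_injL).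
have th52 : th5 != th2 by rewrite -th4q -th1q (inj_eq frob_injL).
by rewrite !mulf_neq0 // subr_eq0.
Qed.

(* Lagrange interpolation at [{th0, th3} * {th1, th4} * {th2, th5}]: [b_j] is the coefficient of
   [w_j * w_(j+1) * w_(j+2)] in [dot_interp]. *)
Definition b0 phi := tri (ico phi) 1 th3 th4 th5 / disc.
Definition b1 phi := - (tri (ico phi) 1 th0 th4 th5 / disc).
Definition b2 phi := tri (ico phi) 1 th0 th1 th5 / disc.
Definition b3 phi := - (tri (ico phi) 1 th0 th1 th2 / disc).
Definition b4 phi := tri (ico phi) 1 th3 th1 th2 / disc.
Definition b5 phi := - (tri (ico phi) 1 th3 th4 th2 / disc).
Definition a0 phi := - (tri (ico phi) 1 th3 th1 th5 / disc).
Definition a1 phi := tri (ico phi) 1 th0 th4 th2 / disc.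

Lemma b_frob phi : phi \in U1 ->
  [/\ b0 phi ^+ q = b1 phi, b1 phi ^+ q = b2 phi & b2 phi ^+ q = b3 phi] /\
  [/\ b3 phi ^+ q = b4 phi, b4 phi ^+ q = b5 phi & b5 phi ^+ q = b0 phi].
Proof.
by move=> pU; rewrite /b0 /b1 /b2 /b3 /b4 /b5; split; split;
  rewrite ?frobNL exprMn exprVn tri_frob // disc_frob !thq invrN mulrN ?opprK.
Qed.

Lemma a_frob phi : phi \in U1 -> a0 phi ^+ q = a1 phi /\ a1 phi ^+ q = a0 phi.
Proof.
by move=> pU; rewrite /a0 /a1; split;
  rewrite ?frobNL exprMn exprVn tri_frob // disc_frob !thq invrN mulrN ?opprK.
Qed.

Definition w0 o := iota (px o) - iota (ps o) * th0.
Definition w1 o := iota (px o) ^+ q - iota (ps o) * th1.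
Definition w2 o := iota (px o) ^+ q ^+ q - iota (ps o) * th2.
Definition w3 o := iota (px o) - iota (ps o) * th3.
Definition w4 o := iota (px o) ^+ q - iota (ps o) * th4.
Definition w5 o := iota (px o) ^+ q ^+ q - iota (ps o) * th5.

Lemma w_frob o :
  [/\ w0 o ^+ q = w1 o, w1 o ^+ q = w2 o & w2 o ^+ q = w3 o] /\
  [/\ w3 o ^+ q = w4 o, w4 o ^+ q = w5 o & w5 o ^+ q = w0 o].
Proof.
have sq : iota (ps o) ^+ q = iota (ps o).
  by case: o => [t|] /=; rewrite ?rmorph1 ?rmorph0 ?expr1n // -(rmorph0 iota) -rmorphXn frob0.
have xq : iota (px o) ^+ q ^+ q ^+ q = iota (px o) by rewrite -!rmorphXn /= frob3.
by rewrite /w0 /w1 /w2 /w3 /w4 /w5; split; split; rewrite !frobL sq ?xq.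
Qed.

Lemma tri_interp (c : nat -> L) (s x y z : L) : tri c s x y z * disc =
    tri c 1 th3 th4 th5 * ((x - s * th0) * (y - s * th1) * (z - s * th2))
  - tri c 1 th0 th4 th5 * ((x - s * th3) * (y - s * th1) * (z - s * th2))
  + tri c 1 th0 th1 th5 * ((x - s * th3) * (y - s * th4) * (z - s * th2))
  - tri c 1 th0 th1 th2 * ((x - s * th3) * (y - s * th4) * (z - s * th5))
  + tri c 1 th3 th1 th2 * ((x - s * th0) * (y - s * th4) * (z - s * th5))
  - tri c 1 th3 th4 th2 * ((x - s * th0) * (y - s * th1) * (z - s * th5))
  - tri c 1 th3 th1 th5 * ((x - s * th0) * (y - s * th4) * (z - s * th2))
  + tri c 1 th0 th4 th2 * ((x - s * th3) * (y - s * th1) * (z - s * th5)).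
Proof. by rewrite /tri /disc; ring. Qed.

Lemma dot_interp phi o : iota (dot phi (pt o)) =
    b0 phi * (w0 o * w1 o * w2 o) + b1 phi * (w1 o * w2 o * w3 o)
  + b2 phi * (w2 o * w3 o * w4 o) + b3 phi * (w3 o * w4 o * w5 o)
  + b4 phi * (w4 o * w5 o * w0 o) + b5 phi * (w5 o * w0 o * w1 o)
  + a0 phi * (w0 o * w2 o * w4 o) + a1 phi * (w1 o * w3 o * w5 o).
Proof.
have -> : iota (dot phi (pt o)) = tri (ico phi) (iota (ps o)) (iota (px o))
    (iota (px o) ^+ q) (iota (px o) ^+ q ^+ q).
  by rewrite dot_pt /tri /ico -!rmorphXn /= !(rmorphD, rmorphM).
have d0 := disc_neq0; rewrite -[LHS](mulfK d0) tri_interp.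
rewrite -/(w0 o) -/(w1 o) -/(w2 o) -/(w3 o) -/(w4 o) -/(w5 o).
rewrite /b0 /b1 /b2 /b3 /b4 /b5 /a0 /a1.
by ring.
Qed.

Lemma triB phi psi (x y z : L) : tri (ico (phi - psi)) 1 x y z =
  tri (ico phi) 1 x y z - tri (ico psi) 1 x y z.
Proof. by rewrite /tri /ico -scaleN1r !coD !coZ !rmorphD !rmorphM rmorphN1; ring. Qed.

Lemma triZ k phi (x y z : L) : tri (ico (k *: phi)) 1 x y z =
  iota k * tri (ico phi) 1 x y z.
Proof. by rewrite /tri /ico !coZ !rmorphM; ring. Qed.

Lemma b0B phi psi : b0 (phi - psi) = b0 phi - b0 psi.
Proof. by rewrite /b0 triB mulrBl. Qed.
Lemma b0Z k phi : b0 (k *: phi) = iota k * b0 phi.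
Proof. by rewrite /b0 triZ mulrA. Qed.
Lemma a0B phi psi : a0 (phi - psi) = a0 phi - a0 psi.
Proof. by rewrite /a0 triB mulrBl opprB addrC opprK. Qed.
Lemma a0Z k phi : a0 (k *: phi) = iota k * a0 phi.
Proof. by rewrite /a0 triZ mulrN mulrA. Qed.

(** All eight coefficients in [dot_interp] are conjugates of [a0 phi] and [b0 phi], so these two are
    faithful coordinates on [U1]. *)
Lemma ab_eq0 phi : phi \in U1 -> a0 phi = 0 -> b0 phi = 0 -> phi = 0.
Proof.
move=> pU a00 b00; apply: pt_nondeg => // o; apply: (fmorph_inj iota).
have [[b01 b12 b23] [b34 b45 _]] := b_frob pU; have [a01 _] := a_frob pU.
have z0 : (0 : L) ^+ q = 0 by rewrite expr0n gtn_eqF.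
rewrite dot_interp rmorph0 -b45 -b34 -b23 -b12 -b01 -a01 a00 b00 !z0; ring.
Qed.

Lemma w0_neq0 o : w0 o != 0.
Proof.
rewrite /w0; case: o => [t|] /=; last by rewrite rmorph0 mul0r subr0 rmorph1 oner_neq0.
rewrite rmorph1 mul1r subr_eq0; apply: contraNneq th30 => tth.
by rewrite -th2q -th1q -th0q -tth -!rmorphXn /= frob3.
Qed.

Lemma w_neq0 o :
  [/\ w0 o != 0, w1 o != 0 & w2 o != 0] /\ [/\ w3 o != 0, w4 o != 0 & w5 o != 0].
Proof.
have [[<- <- <-] [<- <- _]] := w_frob o.
by rewrite !expf_eq0 q_gt0 /= w0_neq0.
Qed.

(** A Möbius coordinate sending [th0] to 0 and [th3] to infinity; by [u_frob3] and [u_surj] it maps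
    the projective line over [F] onto the nonzero solutions of v^(q^3) = v^-1. *)
Definition u o := w0 o / w3 o.

Lemma u_inj : injective u.
Proof.
move=> o o'; rewrite /u; have [_ [w30 _ _]] := w_neq0 o; have [_ [w30' _ _]] := w_neq0 o'.
move/eqP; rewrite eqr_div // /w0 /w3 -subr_eq0 => /eqP eqw.
have : (iota (px o) * iota (ps o') - iota (px o') * iota (ps o)) * (th3 - th0) = 0.
  by rewrite -[RHS]oppr0 -eqw; ring.
move/eqP; rewrite mulf_eq0 !subr_eq0 (negPf th30) orbF.
case: o {eqw w30} => [t|]; case: o' {w30'} => [t'|] //=;
  rewrite ?rmorph1 ?rmorph0 ?mulr1 ?mulr0 ?mul0r ?mul1r ?oner_eq0 //.
- by move/eqP/fmorph_inj->.
- by rewrite eq_sym oner_eq0.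
Qed.

(* The degeneracy at [x = th0] is a relation [b1 * b3 = a1 * b2]; if the coefficients were nonzero, its
   conjugates would make the polar form of [pivot] vanish at [(th0, th3)]. *)
Lemma pivot_root_b0 h : h \in U1 -> pivot (ico h) th0 = 0 -> pivot (ico h) th3 = 0 ->
  ico h 4 * ico h 7 != ico h 5 * ico h 6 -> b0 h = 0.
Proof.
move=> hU Q0 Q3 lc.
have [[b01 b12 b23] [b34 b45 b50]] := b_frob hU; have [a01 a10] := a_frob hU.
have d0 := disc_neq0.
apply/eqP; apply: contraNT lc => b00.
have bn0 x : x != 0 -> x ^+ q != 0 :> L by move=> x0; rewrite expf_neq0.
have b10 : b1 h != 0 by rewrite -b01 bn0.
have b20 : b2 h != 0 by rewrite -b12 bn0.
have b30 : b3 h != 0 by rewrite -b23 bn0.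
have e1 : b1 h * b3 h = a1 h * b2 h.
  apply/eqP; rewrite -subr_eq0; apply/eqP.
  transitivity (pivot (ico h) th0 * ((th1 - th4) * (th2 - th5)) / disc ^+ 2).
    by rewrite /b1 /b2 /b3 /a1 /pivot /tri; field.
  by rewrite Q0 !mul0r.
have e2 : b2 h * b4 h = a0 h * b3 h.
  by have := congr1 (fun x => x ^+ q) e1; rewrite /= (exprMn _ (b1 h)) (exprMn _ (a1 h)) b12 b34 a10 b23.
have p14 : b1 h * b4 h = a0 h * a1 h.
  apply: (mulfI (mulf_neq0 b20 b30)).
  have -> : b2 h * b3 h * (b1 h * b4 h) = (b1 h * b3 h) * (b2 h * b4 h) by ring.
  by rewrite e1 e2; ring.
have p25 : b2 h * b5 h = a0 h * a1 h.
  by have := congr1 (fun x => x ^+ q) p14; rewrite /= (exprMn _ (b1 h)) (exprMn _ (a0 h)) b12 b45 a10 a01 (mulrC (a1 h)).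
have p30 : b3 h * b0 h = a0 h * a1 h.
  by have := congr1 (fun x => x ^+ q) p25; rewrite /= (exprMn _ (b2 h)) (exprMn _ (a0 h)) b23 b50 a10 a01 (mulrC (a1 h)).
have : b3 h * b0 h + b1 h * b4 h - b2 h * b5 h - a0 h * a1 h = 0 by rewrite p14 p25 p30; ring.
(* These are the coefficients of [pivot]; its two roots [th0] and [th3] give Vieta's relations [K1]
   and [K00]. *)
pose k0 := ico h 0 * ico h 3 - ico h 2 * ico h 1.
pose k1 := ico h 0 * ico h 7 + ico h 4 * ico h 3 - ico h 2 * ico h 5 - ico h 6 * ico h 1.
pose k2 := ico h 4 * ico h 7 - ico h 5 * ico h 6.
have t30 : th3 - th0 != 0 by rewrite subr_eq0.
have K0 : k0 + k1 * th0 + k2 * th0 ^+ 2 = 0 by rewrite -Q0 /pivot /k0 /k1 /k2; ring.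
have K3 : k0 + k1 * th3 + k2 * th3 ^+ 2 = 0 by rewrite -Q3 /pivot /k0 /k1 /k2; ring.
have K1 : k1 = - k2 * (th0 + th3).
  apply/(mulfI t30)/eqP; rewrite -subr_eq0; apply/eqP.
  by transitivity (0 - 0 : L); [rewrite -{1}K3 -K0; ring | rewrite subr0].
have K00 : k0 = k2 * th0 * th3.
  by apply/eqP; rewrite -subr_eq0 -K0 K1; apply/eqP; ring.
move=> pol.
(* By Vieta the polar form at [th0], [th3] equals [- k2 * (th3 - th0) ^+ 2], so the argument covers
   characteristic 2 as well. *)
have : k2 * (th3 - th0) ^+ 2 * ((th4 - th1) * (th5 - th2)) / disc ^+ 2 = 0.
  rewrite -pol.
  transitivity (- (2%:R * k0 + k1 * (th0 + th3) + 2%:R * k2 * th0 * th3)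
     * ((th4 - th1) * (th5 - th2)) / disc ^+ 2).
    by rewrite K1 K00; field.
  by rewrite /b0 /b1 /b2 /b3 /b4 /b5 /a0 /a1 /k0 /k1 /k2 /tri; field.
move: d0; rewrite /disc !mulf_eq0 !negb_or => /andP[/andP[t3 t4] t5].
move/eqP; rewrite !mulf_eq0 invr_eq0 !expf_eq0 !mulf_eq0 /=.
by rewrite (negPf t3) (negPf t4) (negPf t5) /= !orbF subr_eq0.
Qed.

(** * Functionals restricted to the section by [h]: the del Pezzo surface *)

Variable h : 'rV[F]_8.
Hypothesis hU : h \in U1.
Hypothesis h_neq0 : h != 0.
Hypothesis hb0 : b0 h = 0.

Lemma a0h : a0 h != 0.
Proof. by apply: contraNneq h_neq0 => ah; rewrite (ab_eq0 hU ah hb0). Qed.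

Lemma a1h : a1 h != 0.
Proof. by have [<- _] := a_frob hU; rewrite expf_neq0 ?a0h. Qed.

Lemma zero_frobL : (0 : L) ^+ q = 0. Proof. by rewrite expr0n gtn_eqF. Qed.

Lemma b_eq0 phi : phi \in U1 -> b0 phi = 0 ->
  [/\ b1 phi = 0, b2 phi = 0, b3 phi = 0, b4 phi = 0 & b5 phi = 0].
Proof.
move=> pU b00; have [[b01 b12 b23] [b34 b45 _]] := b_frob pU.
by rewrite -b45 -b34 -b23 -b12 -b01 b00 !zero_frobL.
Qed.

Definition cc : L := - a1 h / a0 h.

Lemma cc_neq0 : cc != 0.
Proof. by rewrite mulf_neq0 ?oppr_eq0 ?invr_eq0 ?a0h ?a1h. Qed.

Lemma mem_zeros_h o :
  (o \in zeros h) = (w0 o * w2 o * w4 o == cc * (w1 o * w3 o * w5 o)).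
Proof.
rewrite inE -(inj_eq (fmorph_inj iota)) dot_interp rmorph0.
have [-> -> -> -> ->] := b_eq0 hU hb0; rewrite hb0 !mul0r !add0r.
rewrite -[RHS]subr_eq0 -[RHS](inj_eq (mulfI a0h)) mulr0; congr (_ == _).
by rewrite /cc; field; exact: a0h.
Qed.

(* On [zeros h] the third coordinate [z = w2 / w5] is eliminated by [u * yy * z = cc]. *)
Definition yy o := w4 o / w1 o.
Definition ac phi := a1 phi + a0 phi * cc.

Lemma u_neq0 o : u o != 0.
Proof. by have [[w00 _ _] [w30 _ _]] := w_neq0 o; rewrite mulf_neq0 ?invr_eq0. Qed.

Lemma yy_neq0 o : yy o != 0.
Proof. by have [[_ w10 _] [_ w40 _]] := w_neq0 o; rewrite mulf_neq0 ?invr_eq0. Qed.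

Lemma u_frob o : u o ^+ q = (yy o)^-1.
Proof.
have [[wq _ _] [wq3 _ _]] := w_frob o.
by rewrite /u /yy exprMn exprVn wq wq3 invf_div.
Qed.

(** Division by w1 w3 w5 turns the eight monomials of [dot_interp] into xz, z, yz, y, xy, x, xyz, 1.
    The factor [u o * yy o] clears the denominator of z, and xyz = cc merges the last two terms into
    [ac]. *)
Lemma dot_quad phi o : o \in zeros h ->
  iota (dot phi (pt o)) * (u o * yy o / (w1 o * w3 o * w5 o)) =
  (b4 phi * u o ^+ 2 + b3 phi * u o) * yy o ^+ 2
  + (b5 phi * u o ^+ 2 + ac phi * u o + b2 phi * cc) * yy o
  + cc * (b0 phi * u o + b1 phi).
Proof.
rewrite mem_zeros_h => /eqP oh; have [[w00 w10 w20] [w30 w40 w50]] := w_neq0 o.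
rewrite /ac; have -> : cc = w0 o * w2 o * w4 o / (w1 o * w3 o * w5 o).
  by rewrite oh mulfK // !mulf_neq0.
by rewrite dot_interp /u /yy; field; rewrite w10 w30 w50.
Qed.

(** Were the minor nonzero, so would be its conjugates in [m4] and [m5], the leading coefficients of
    the two cubics in [sextic_roots]; more than six distinct values of [u] contradict that lemma. *)
Lemma b_minor_eq0 phi psi (T : {set option F}) : phi \in U1 -> psi \in U1 ->
  T \subset zeros h -> T \subset zeros phi -> T \subset zeros psi -> (6 < #|T|)%N ->
  b0 phi * b1 psi = b1 phi * b0 psi.
Proof.
move=> pU pU' /subsetP Th /subsetP Tp /subsetP Tp' T7.
have [[b01 b12 b23] [b34 b45 b50]] := b_frob pU.
have [[b01' b12' b23'] [b34' b45' b50']] := b_frob pU'.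
apply/eqP; rewrite -subr_eq0; apply/negPn/negP => m0.
have step (x y x' y' : L) : x * y' - y * x' != 0 ->
    x ^+ q * y' ^+ q - y ^+ q * x' ^+ q != 0.
  by move=> n0; rewrite -!exprMn -frobBL expf_neq0.
have m1 := step _ _ _ _ m0; rewrite b01 b01' b12 b12' in m1.
have m2 := step _ _ _ _ m1; rewrite b12 b12' b23 b23' in m2.
have m3 := step _ _ _ _ m2; rewrite b23 b23' b34 b34' in m3.
have m4 := step _ _ _ _ m3; rewrite b34 b34' b45 b45' in m4.
have m5 := step _ _ _ _ m4; rewrite b45 b45' b50 b50' in m5.
have us : uniq [seq u o | o <- enum T] by rewrite (map_inj_uniq u_inj) enum_uniq.
have := sextic_roots (mulf_neq0 m4 m5) us.
(* For quadratics in [yy] with coefficients A, B, C and A', B', C', these are coefficients of the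
   minors AC' - CA', AB' - BA', BC' - CB' after removal of the factors cc u, u, cc. *)
move/(_ cc (b3 phi * b1 psi - b1 phi * b3 psi)
 (b4 phi * b1 psi + b3 phi * b0 psi - b0 phi * b3 psi - b1 phi * b4 psi)
 (b4 phi * b0 psi - b0 phi * b4 psi)
 (b3 phi * (b2 psi * cc) - b2 phi * cc * b3 psi)
 (b4 phi * (b2 psi * cc) + b3 phi * ac psi - b2 phi * cc * b4 psi - ac phi * b3 psi)
 (b4 phi * ac psi + b3 phi * b5 psi - ac phi * b4 psi - b5 phi * b3 psi)
 (b2 phi * cc * b1 psi - b1 phi * (b2 psi * cc))
 (ac phi * b1 psi + b2 phi * cc * b0 psi - b0 phi * (b2 psi * cc) - b1 phi * ac psi)
 (b5 phi * b1 psi + ac phi * b0 psi - b0 phi * ac psi - b1 phi * b5 psi)).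
rewrite size_map -cardE leqNgt T7 => /(_ _)/notF; apply=> v /mapP[o]; rewrite mem_enum => oT ->.
have quad (chi : 'rV_8) : o \in zeros chi ->
  (b4 chi * u o ^+ 2 + b3 chi * u o) * yy o ^+ 2
  + (b5 chi * u o ^+ 2 + ac chi * u o + b2 chi * cc) * yy o
  + cc * (b0 chi * u o + b1 chi) = 0.
  by rewrite inE => /eqP o0; rewrite -dot_quad ?Th // o0 rmorph0 mul0r.
have := quad _ (Tp _ oT); have := quad _ (Tp' _ oT).
move: (b0 phi) (b1 phi) (b2 phi) (b3 phi) (b4 phi) (b5 phi) (ac phi).
move: (b0 psi) (b1 psi) (b2 psi) (b3 psi) (b4 psi) (b5 psi) (ac psi).
move: (u o) (yy o) cc (yy_neq0 o) => x y c y0.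
move=> e0 e1 e2 e3 e4 e5 e d0 d1 d2 d3 d4 d5 d eqe eqd.
set k := (X in _ = _ * X); set n := (X in _ = X * _); set m := (X in _ * X ^+ 2 = _).
(* Eliminating the [y ^+ 2] terms gives [ny], eliminating the constant terms gives [ky]; together
   they give the relation. *)
have ny : n * y = - c * m.
  apply/eqP; rewrite -subr_eq0; apply/eqP.
  transitivity (((d4 * x + d3) * 0 - (e4 * x + e3) * 0 : L)); last by ring.
  by rewrite -{1}eqe -eqd /n /m; ring.
have ky : k = - x * y * m.
  apply: (mulfI y0); apply/eqP; rewrite -subr_eq0; apply/eqP.
  transitivity (((e0 * x + e1) * 0 - (d0 * x + d1) * 0 : L)); last by ring.
  by rewrite -{1}eqd -eqe /k /m; ring.
rewrite ky; transitivity (- x * m * (n * y)); last by ring.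
by rewrite ny; ring.
Qed.

(** Without the [b_j] only two terms remain, and one common zero forces the ratio of [a1] to [a0] to
    be that of [h]. The quotient [a0 phi / a0 h] is then fixed by the Frobenius map. *)
Lemma b0_eq0_prop phi o : phi \in U1 -> b0 phi = 0 -> o \in zeros h ->
  o \in zeros phi -> exists2 k, k \in Fq & phi = k *: h.
Proof.
move=> pU pb oh op; have [ah01 ah10] := a_frob hU; have [ap01 ap10] := a_frob pU.
have [[w00 w10 w20] [w30 w40 w50]] := w_neq0 o.
have := dot_interp phi o; have [-> -> -> -> ->] := b_eq0 pU pb; rewrite pb !mul0r !add0r.
move: oh; rewrite mem_zeros_h => /eqP->; move: op; rewrite inE => /eqP->.
rewrite rmorph0 (mulrA (a0 phi) cc) -mulrDl => /esym/eqP.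
rewrite mulf_eq0 (mulf_eq0 (_ * _) (w5 o)) (mulf_eq0 (w1 o) (w3 o)).
rewrite (negPf w10) (negPf w30) (negPf w50) !orbF => /eqP acp.
have a1p : a1 phi = a0 phi * (a1 h / a0 h).
  by apply/eqP; rewrite -subr_eq0 -acp /cc; apply/eqP; field; exact: a0h.
have [|k kq kE] := @frob1_im (a0 phi / a0 h).
  rewrite exprMn exprVn ap01 ah01 a1p; field; by rewrite a0h a1h.
exists k => //; apply/eqP; rewrite -subr_eq0; apply/eqP; apply: ab_eq0.
- by rewrite U1B ?U1Z.
- by rewrite a0B a0Z -kE divfK ?subrr ?a0h.
- by rewrite b0B b0Z pb hb0 mulr0 subrr.
Qed.

Lemma common_zeros phi psi (T : {set option F}) : phi \in U1 -> psi \in U1 ->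
  T \subset zeros h -> T \subset zeros phi -> T \subset zeros psi -> (6 < #|T|)%N ->
  (exists2 k, k \in Fq & psi = k *: h) \/
  (exists k l, [/\ k \in Fq, l \in Fq & phi = k *: psi + l *: h]).
Proof.
move=> pU pU' Th Tp Tp' T7; have minor := b_minor_eq0 pU pU' Th Tp Tp' T7.
have /set0Pn[o oT] : T != set0 by rewrite -card_gt0; apply: leq_trans T7.
have oh := subsetP Th o oT; have op := subsetP Tp o oT; have op' := subsetP Tp' o oT.
have [b00|b00] := eqVneq (b0 psi) 0; first by left; exact: b0_eq0_prop op'.
have [[b01 _ _] _] := b_frob pU; have [[b01' _ _] _] := b_frob pU'.
have [|k kq kE] := @frob1_im (b0 phi / b0 psi).
  rewrite exprMn exprVn b01 b01'; apply/eqP; rewrite eqr_div // -?b01' ?expf_neq0 //.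
  by rewrite b01' -minor mulrC.
have kU : phi - k *: psi \in U1 by rewrite U1B ?U1Z.
have [||l lq lE] := b0_eq0_prop kU _ oh.
- by rewrite b0B b0Z -kE divfK ?subrr.
- move: op op'; rewrite !inE dotBl dotZl => /eqP-> /eqP->.
  by rewrite mulr0 subrr.
by right; exists k, l; split=> //; rewrite -lE addrC subrK.
Qed.

(** Since [yy] is u^(-q), multiplying [dot_quad] by u^(2q) gives a polynomial in u of degree at most
    2q + 1, less than q^2 - q + 1; its coefficient at 2q + 1 is [cc * b0 phi]. *)
Lemma zeros_h_sub phi : phi \in U1 -> #|zeros h| = (q ^ 2 - q + 1)%N ->
  zeros h \subset zeros phi -> exists2 k, k \in Fq & phi = k *: h.
Proof.
move=> pU ch /subsetP hp.
have Q4 : (4 * q <= q ^ 2)%N by rewrite -mulnn leq_mul2r q_ge4 orbT.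
have /set0Pn[o oh] : zeros h != set0 by rewrite -cards_eq0; lia.
apply: (b0_eq0_prop pU _ oh); last exact: hp.
pose p : {poly L} := b4 phi *: 'X^2 + b3 phi *: 'X^1
  + (b5 phi *: 'X^(q + 2) + ac phi *: 'X^(q + 1) + (b2 phi * cc) *: 'X^q)
  + ((cc * b1 phi) *: 'X^(q + q) + (cc * b0 phi) *: 'X^(q + q + 1)).
have rp : all (root p) [seq u o | o <- enum (zeros h)].
  apply/allP => v /mapP[o']; rewrite mem_enum => oh' ->.
  have := dot_quad phi oh'; have := hp _ oh'; rewrite inE => /eqP->.
  rewrite rmorph0 mul0r => /esym eq0; rewrite /root /p !(hornerD, hornerZ, hornerXn) !exprD u_frob.
  have y0 := yy_neq0 o'.
  apply/eqP; transitivity ((0 : L) * (yy o') ^- 2); last by rewrite mul0r.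
  by rewrite -eq0; field.
have us : uniq [seq u o | o <- enum (zeros h)] by rewrite (map_inj_uniq u_inj) enum_uniq.
have p0 : p = 0.
  apply/eqP; apply: contraT => pn0; have := max_poly_roots pn0 rp us.
  have : (size p <= q + q + 2)%N.
    rewrite /p; repeat (apply: leq_trans (size_polyD _ _) _; rewrite geq_max; apply/andP; split);
      by apply: leq_trans (size_scale_leq _ _) _; rewrite size_polyXn; clear -q_ge4; lia.
  by rewrite size_map -cardE ch => szp /leq_trans/(_ szp); clear -Q4 q_ge4; lia.
have : p`_(q + q + 1) = 0 by rewrite p0 coef0.
rewrite /p !(coefD, coefZ, coefXn) eqxx; do ![case: eqP => [E|_]; first by clear -q_ge4 E; lia].
rewrite !mulr0 !add0r mulr1 => /eqP.
by rewrite (mulf_eq0 cc) (negPf cc_neq0) => /eqP.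
Qed.

Lemma mem_zeros_u o : (o \in zeros h) = (u o * u o ^+ q ^+ q == cc * u o ^+ q).
Proof.
rewrite mem_zeros_h; have [[w00 w10 w20] [w30 w40 w50]] := w_neq0 o.
have [[w01 w12 _] [w34 w45 _]] := w_frob o.
rewrite /u !exprMn !exprVn w01 w12 w34 w45 -[LHS]subr_eq0 -[RHS]subr_eq0.
transitivity ((w0 o * w2 o * w4 o - cc * (w1 o * w3 o * w5 o)) / (w3 o * w4 o * w5 o) == 0).
  by rewrite (mulf_eq0 (_ - _)) invr_eq0 !(mulf_eq0 _ (w5 o)) (mulf_eq0 (w3 o))
    (negPf w30) (negPf w40) (negPf w50) !orbF.
by congr (_ == _); field; rewrite w30 w40 w50 ?oner_neq0.
Qed.

Lemma u_frob3 o : u o ^+ q ^+ q ^+ q = (u o)^-1.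
Proof.
have [[w01 w12 w23] [w34 w45 w50]] := w_frob o.
by rewrite /u !exprMn !exprVn w01 w12 w23 w34 w45 w50 invf_div.
Qed.

(** The inverse Möbius map gives t = (th0 - v th3) / (1 - v), and the condition on v says t^(q^3) =
    t; v = 1 is the point at infinity. *)
Lemma u_surj v : v != 0 -> v ^+ q ^+ q ^+ q = v^-1 -> exists o, u o = v.
Proof.
move=> v0 vq; have [v1|v1] := eqVneq v 1.
  by exists None; rewrite /u /w0 /w3 /= rmorph0 rmorph1 !mul0r !subr0 divr1.
have v1' : 1 - v != 0 by rewrite subr_eq0 eq_sym.
have [|t tE] := @frob3_im ((th0 - v * th3) / (1 - v)).
  rewrite !(exprMn, exprVn, frobBL, thq) !expr1n vq; field.
  by rewrite v0 v1' /= -opprB oppr_eq0 v1'.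
exists (Some t); rewrite /u /w0 /w3 /= rmorph1 !mul1r -tE.
have t30 : th3 - th0 != 0 by rewrite subr_eq0.
have d1 : th0 - th3 != 0 by rewrite -opprB oppr_eq0.
by field; rewrite v1' /=; apply/eqP => e; move/eqP: d1; apply; rewrite -e; ring.
Qed.

Lemma frob_sqr_div (x y : L) : (x ^+ 2 / y) ^+ q = (x ^+ q) ^+ 2 / y ^+ q.
Proof. by rewrite exprMn exprVn exprAC. Qed.

(** * The involution, and functionals with eight zeros on the section *)

Section Involution.
Variable o0 : option F.
Hypothesis o0h : o0 \in zeros h.

Lemma involution_ex o : o \in zeros h ->
  exists2 o', o' \in zeros h & u o' = u o0 ^+ 2 / u o.
Proof.
move=> oh; have un0 := u_neq0.
have [||o' o'E] := @u_surj (u o0 ^+ 2 / u o).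
- by rewrite mulf_neq0 ?invr_eq0 ?expf_neq0.
- by rewrite !frob_sqr_div !u_frob3; field; rewrite !un0 ?oner_neq0.
exists o' => //; rewrite mem_zeros_u o'E.
move: oh o0h; rewrite !mem_zeros_u => /eqP eo /eqP eo0.
rewrite !frob_sqr_div; apply/eqP.
transitivity ((u o0 * u o0 ^+ q ^+ q) ^+ 2 / (u o * u o ^+ q ^+ q)).
  by field; rewrite !expf_neq0 ?un0 ?oner_neq0.
by rewrite eo eo0; field; rewrite cc_neq0 expf_neq0 ?un0 ?oner_neq0.
Qed.

(** On [zeros h] the choice succeeds by [involution_ex]; the default [o] only makes [tau] total. *)
Definition tau o :=
  odflt o [pick o' | (o' \in zeros h) && (u o' == u o0 ^+ 2 / u o)].

Lemma tauP o : o \in zeros h -> tau o \in zeros h /\ u (tau o) = u o0 ^+ 2 / u o.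
Proof.
move=> oh; rewrite /tau; case: pickP => [o' /andP[? /eqP] //|none].
by have [o' oh' oE] := involution_ex oh; have := none o'; rewrite oh' oE eqxx.
Qed.

Lemma tauK o : o \in zeros h -> tau (tau o) = o.
Proof.
move=> oh; have [th tE] := tauP oh; have [_ ttE] := tauP th.
apply: u_inj; rewrite ttE tE; field; by rewrite !u_neq0 ?oner_neq0.
Qed.

(** A fixed point has u equal to [u o0] or to its negative. A change of sign alters only one side of
    the equation in [mem_zeros_u], so the second case gives cc = -cc, and the two values
    coincide. *)
Lemma tau_fix o : o \in zeros h -> tau o = o -> o = o0.
Proof.
move=> oh to; have [_] := tauP oh; rewrite to => uE; apply: u_inj.
have /eqP : u o ^+ 2 = u o0 ^+ 2 by rewrite {1}expr2 {2}uE mulrCA divff ?mulr1 ?u_neq0.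
rewrite eqf_sqr => /orP[/eqP//|/eqP uN].
move: oh o0h; rewrite !mem_zeros_u uN !frobNL mulrNN => /eqP-> .
rewrite mulrN -mulNr => /eqP /(mulIf _) ccN.
have {}ccN : - cc = cc by apply: ccN; rewrite expf_neq0 ?u_neq0.
by apply: (mulfI cc_neq0); rewrite mulrN -mulNr ccN.
Qed.

(** As yz = cc / x on the surface, the equation says that b5 x + b2 yz is invariant under x -> x0^2
    / x, where x0 is [u o0]. Its Frobenius conjugates say the same of the pairs y, zx and z, xy. *)
Definition symm : {set 'rV[F]_8} :=
  [set phi in U1 | b2 phi * cc - b5 phi * u o0 ^+ 2 == 0].

Lemma symmP phi :
  reflect (phi \in U1 /\ b2 phi * cc = b5 phi * u o0 ^+ 2) (phi \in symm).
Proof.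
rewrite /symm [X in reflect _ X]in_set; apply: (iffP andP) => -[pU e]; split=> //.
  by apply/eqP; rewrite -subr_eq0.
by rewrite e subrr.
Qed.

Lemma cc_frob : cc ^+ q = cc^-1.
Proof.
have [ah01 ah10] := a_frob hU.
rewrite /cc exprMn exprVn frobNL ah01 ah10; move: a0h a1h.
by move: (a0 h) (a1 h) => x y xn yn; field; rewrite ?oppr_eq0 xn yn.
Qed.

Lemma b2B phi psi : b2 (phi - psi) = b2 phi - b2 psi.
Proof. by rewrite /b2 triB mulrBl. Qed.
Lemma b5B phi psi : b5 (phi - psi) = b5 phi - b5 psi.
Proof. by rewrite /b5 triB mulrBl opprB addrC opprK. Qed.

Lemma symm_zeros phi o : phi \in symm -> o \in zeros h -> o \in zeros phi ->
  tau o \in zeros phi.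
Proof.
move=> /symmP[pU e25] oh op; have [th tE] := tauP oh.
have [[b01 b12 b23] [b34 b45 b50]] := b_frob pU.
have x0n := u_neq0 o0; have y0n := yy_neq0 o0; have xn := u_neq0 o; have yn := yy_neq0 o.
have cn := cc_neq0.
have e30 : b3 phi * yy o0 ^+ 2 = b0 phi * cc.
  have := congr1 (fun x => x ^+ q) e25.
  rewrite (exprMn _ (b2 phi)) (exprMn _ (b5 phi)) b23 b50 cc_frob exprAC u_frob => e.
  have -> : b3 phi = b3 phi / cc * cc by rewrite divfK.
  by rewrite e; field.
have uqq : u o0 ^+ q ^+ q = cc / (u o0 * yy o0).
  move: o0h; rewrite mem_zeros_u => /eqP e; apply: (mulfI x0n); rewrite e u_frob.
  by field; rewrite x0n y0n ?oner_neq0.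
have yq : yy o0 ^+ q = u o0 * yy o0 / cc.
  by rewrite -{1}[yy o0]invrK -u_frob exprVn uqq invf_div.
have e41 : b4 phi * (u o0 * yy o0) ^+ 2 = cc * b1 phi.
  have := congr1 (fun x => x ^+ q) e30.
  rewrite (exprMn _ (b3 phi)) (exprMn _ (b0 phi)) b34 b01 cc_frob exprAC yq => e.
  transitivity (b4 phi * (u o0 * yy o0 / cc) ^+ 2 * cc ^+ 2); first by field.
  by rewrite e; field.
have ytE : yy (tau o) = yy o0 ^+ 2 / yy o.
  apply: invr_inj; rewrite -u_frob tE frob_sqr_div !u_frob; field.
  by rewrite y0n yn ?oner_neq0.
have [[_ w10 _] [w30 _ w50]] := w_neq0 (tau o).
move: op; rewrite !inE => /eqP op; rewrite -(inj_eq (fmorph_inj iota)) rmorph0.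
have wn : w1 (tau o) * w3 (tau o) * w5 (tau o) != 0 by rewrite !mulf_neq0.
have fn : u (tau o) * yy (tau o) / (w1 (tau o) * w3 (tau o) * w5 (tau o)) != 0.
  by rewrite mulf_neq0 ?invr_eq0 // mulf_neq0 ?u_neq0 ?yy_neq0.
rewrite -(inj_eq (mulIf fn)) mul0r dot_quad // tE ytE; apply/eqP.
have := dot_quad phi oh; rewrite op rmorph0 mul0r.
have e01 X : cc * (b0 phi * X + b1 phi) =
    b3 phi * yy o0 ^+ 2 * X + b4 phi * (u o0 * yy o0) ^+ 2.
  by rewrite e30 e41; ring.
rewrite !e01 e25.
move: (u o) (yy o) (u o0) (yy o0) xn yn x0n y0n => x y x0 y0 xn yn x0n y0n /esym eq0.
(* Under [tau] the quadratic of [dot_quad] is multiplied by this factor. *)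
transitivity (0 * ((x0 * y0) ^+ 2 / (x * y) ^+ 2)); last by rewrite mul0r.
by rewrite -eq0; field; rewrite xn yn ?oner_neq0.
Qed.

(** The expression [e phi] satisfies e^(q^3) = - e / (cc x0^2) with x0 = [u o0], so it takes at most
    q^3 values on the q^8 functionals. *)
Lemma card_symm : (q ^ 5 <= #|symm|)%N.
Proof.
pose e phi := b2 phi * cc - b5 phi * u o0 ^+ 2.
pose s := undup [seq e phi | phi <- enum U1].
have x0n := u_neq0 o0; have cn := cc_neq0.
have : (#|U1| <= size s * #|symm|)%N.
  apply: (leq_card_additive (g := e)) => [x y|x y _ _|x xU].
  - exact: U1B.
  - by rewrite /e b2B b5B; ring.
  - by rewrite mem_undup map_f // mem_enum.
have szs : (size s <= q ^ 3)%N.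
  pose p : {poly L} := 'X^(q ^ 3) + (cc * u o0 ^+ 2)^-1 *: 'X.
  have q31 : (1 < q ^ 3)%N by rewrite -cardF finNzRing_gt1.
  have szp : size p = (q ^ 3).+1.
    rewrite size_polyDl size_polyXn // (leq_ltn_trans (size_scale_leq _ _)) //.
    by rewrite size_polyX ltnS.
  have p0 : p != 0 by rewrite -size_poly_eq0 szp.
  have us : uniq s by exact: undup_uniq.
  suff rs : all (root p) s by have := max_poly_roots p0 rs us; rewrite szp ltnS.
  apply/allP => x; rewrite mem_undup => /mapP[phi]; rewrite mem_enum => pU ->.
  have [[b01 b12 b23] [b34 b45 b50]] := b_frob pU.
  rewrite /root hornerD hornerZ hornerXn hornerX.
  have -> : e phi ^+ (q ^ 3) = e phi ^+ q ^+ q ^+ q by rewrite -!exprM mulnn -expnS.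
  have -> : e phi ^+ q ^+ q ^+ q = b5 phi / cc - b2 phi / u o0 ^+ 2.
    rewrite /e !frobBL !(exprMn _ (b2 phi)) !(exprMn _ (b5 phi)).
    rewrite b23 (exprMn _ (b3 phi)) b34 (exprMn _ (b4 phi)) b45.
    rewrite b50 (exprMn _ (b0 phi)) b01 (exprMn _ (b1 phi)) b12.
    rewrite cc_frob exprVn cc_frob invrK cc_frob !(exprAC _ 2) u_frob3 exprVn //.
  by apply/eqP; rewrite /e; field; rewrite x0n cn ?oner_neq0.
rewrite card_U1 => le8; rewrite -(leq_pmul2l (m := (q ^ 3)%N)) ?expn_gt0 ?q_gt0 //.
by rewrite -expnD (leq_trans le8) // leq_mul2r szs orbT.
Qed.

End Involution.

(* The values at six representatives of the pairs swapped by [tau] form a code of length 6 with at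
   least [4 ^ 4] words over [Fq]. Two words are at distance at most 2, because [4 ^ 4 * 18 > 4 ^ 6];
   their difference vanishes on four pairs. *)
Lemma many_zeros4 : q = 4%N -> #|zeros h| = 13%N ->
  exists f, [/\ f \in U1, f \notin line h & (8 <= #|zeros h :&: zeros f|)%N].
Proof.
move=> q4 ch.
have /set0Pn[o0 o0h] : zeros h != set0 by rewrite -card_gt0 ch.
(* Requiring a zero at a point [o1] off [h] excludes the nonzero multiples of [h] and still leaves
   at least 4^4 words. *)
have [o1 o1h] : exists o1, dot h (pt o1) != 0.
  apply/existsP; apply: contraR h_neq0 => /existsPn h0.
  by rewrite (pt_nondeg hU) // => o; apply/eqP; have := h0 o; rewrite negbK.
pose D := zeros h :\ o0.
have tD o : o \in D -> tau o0 o \in D.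
  rewrite !inE -/(o \in zeros h) => /andP[oo0 oh].
  have oh' : o \in zeros h by rewrite inE.
  have [th tE] := tauP o0h oh'; move: (th); rewrite inE => ->; rewrite andbT.
  apply: contra_neq oo0 => to0; apply: u_inj; apply: (mulfI (u_neq0 o0)).
  by move: tE; rewrite to0 => e; rewrite {1}e -expr2 divfK ?u_neq0.
have Dh o : o \in D -> o \in zeros h by case/setD1P.
have [||| R RD [cR dR]] := @involution_transversal _ D (tau o0).
- exact: tD.
- by move=> o /Dh; apply: tauK.
- by move=> o /setD1P[oo0 oh]; apply: contra_neq oo0 => /(tau_fix o0h oh).
have {}cR : #|R| = 6%N.
  have := cardsD1 o0 (zeros h); rewrite ch o0h -/D cR; clear; lia.
pose Psi := [set phi in symm o0 | dot phi (pt o1) == 0].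
have symmB x y : x \in symm o0 -> y \in symm o0 -> x - y \in symm o0.
  move=> /symmP[xU ex] /symmP[yU ey]; apply/symmP; split; first exact: U1B.
  by rewrite b2B b5B !mulrBl ex ey.
have cPsi : (4 ^ 4 <= #|Psi|)%N.
  have : (#|symm o0| <= size (enum Fq) * #|Psi|)%N.
    apply: (leq_card_additive (g := dot^~ (pt o1))) => [|x y _ _|x /symmP[xU _]] //.
      exact: dotBl.
    by rewrite mem_enum dot_Fq ?pt_in.
  rewrite -cardE card_Fq => /(leq_trans (card_symm o0)); rewrite q4.
  by rewrite (expnS 4 4) leq_pmul2l.
(* [ev] adds to the word of [z.1] a nonzero error [z.2.2] at the position [z.2.1]; six positions and
   three values give the factor 18. *)
pose ev (z : 'rV[F]_8 * ('I_#|R| * F)) : {ffun 'I_#|R| -> F} :=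
  [ffun j => dot z.1 (pt (enum_val j)) + (if j == z.2.1 then z.2.2 else 0)].
pose dom := setX Psi (setX [set: 'I_#|R|] (Fq :\ 0)).
have cdom : #|dom| = (#|Psi| * 18)%N.
  have := cardsD1 0 Fq; rewrite Fq0 card_Fq add1n => e.
  have c3 : #|Fq :\ 0| = 3%N by apply: succn_inj; rewrite -e q4.
  by rewrite !cardsX cardsT card_ord cR c3.
have PsiU x : x \in Psi -> x \in U1 by rewrite inE => /andP[/symmP[]].
have /dinjectivePn[[x [i k]]] : ~~ dinjectiveb ev (mem dom).
  apply/negP => /dinjectiveP inj.
  have := card_in_imset inj; rewrite cdom => cim.
  have : (#|ev @: dom| <= #|[set f : {ffun 'I_#|R| -> F} | f \in ffun_on Fq]|)%N.
    apply/subset_leq_card/subsetP => _ /imsetP[[x [i k]] /setXP[xP /setXP[_ /setD1P[_ kq]]] ->].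
    rewrite inE; apply/ffun_onP => j; rewrite ffunE /=.
    by rewrite FqD ?dot_Fq ?pt_in ?PsiU //; case: ifP; rewrite ?Fq0.
  rewrite cim; have -> : #|[set f : {ffun 'I_#|R| -> F} | f \in ffun_on Fq]| = (4 ^ 6)%N.
    by rewrite cardsE card_ffun_on card_ord cR card_Fq q4.
  by move/(leq_trans (leq_mul cPsi (leqnn 18))).
move=> /setXP[/= xP /setXP[/= _ /setD1P[k0 kq]]] [[y [j l]]].
rewrite inE /= => /andP[ne /setXP[/= yP /setXP[/= _ /setD1P[l0 lq]]]] evE.
have evj m : dot (x - y) (pt (enum_val m)) =
    (if m == j then l else 0) - (if m == i then k else 0).
  have := congr1 (fun f : {ffun _ -> _} => f m) evE; rewrite !ffunE /= dotBl => e.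
  move: e; move: (if m == i then k else 0) (if m == j then l else 0) => a b e.
  by rewrite -[dot x _](addrK a) e; ring.
have xyS : x - y \in symm o0.
  by apply: symmB; [move: xP | move: yP]; rewrite inE => /andP[].
exists (x - y); split.
- by rewrite U1B ?PsiU.
- apply/imsetP => -[a aq xya].
  have : dot (x - y) (pt o1) = 0.
    by move: xP yP; rewrite dotBl !inE => /andP[_ /eqP->] /andP[_ /eqP->]; rewrite subrr.
  rewrite xya dotZl => /eqP; rewrite mulf_eq0 (negPf o1h) orbF => /eqP a0.
  case/negP: ne; apply/eqP; move: (evj i) (evj j); rewrite !eqxx xya a0 scale0r.
  have -> : forall v, dot 0 v = 0 by move=> v; rewrite -(scale0r h) dotZl mul0r.
  have <- : x = y by apply/eqP; rewrite -subr_eq0 xya a0 scale0r.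
  case: (eqVneq i j) => [<- /esym/eqP|_ /esym/eqP].
    by rewrite subr_eq0 => /eqP->.
  by rewrite sub0r oppr_eq0 (negPf k0).
(* Only at the positions [i] and [j] can [x - y] be nonzero, so at least four representatives
   remain. *)
pose B := R :\ enum_val i :\ enum_val j.
have BR : B \subset R by rewrite /B (subset_trans (subD1set _ _)) ?subD1set.
have cB : (4 <= #|B|)%N.
  have := cardsD1 (enum_val i) R; have := cardsD1 (enum_val j) (R :\ enum_val i).
  rewrite cR -/B; move: #|B| #|_ :\ _| (_ \in R) (_ \in _) => a b c d; clear; lia.
have Bz o : o \in B -> o \in zeros (x - y).
  rewrite !inE => /and3P[oj oi oR]; rewrite -(enum_rankK_in oR oR) evj.
  have -> : (enum_rank_in oR o == j) = false.
    by apply: contraNF oj => /eqP<-; rewrite enum_rankK_in.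
  have -> : (enum_rank_in oR o == i) = false.
    by apply: contraNF oi => /eqP<-; rewrite enum_rankK_in.
  by rewrite subrr.
have Bh o : o \in B -> o \in zeros h by move/(subsetP BR)/(subsetP RD)/Dh.
have tinj : {in B &, injective (tau o0)}.
  by move=> o o' /Bh oh /Bh oh' e; rewrite -(tauK o0h oh) e tauK.
have dB : B :&: tau o0 @: B = set0.
  by apply/eqP; rewrite setI_eq0; apply: disjointW BR (imsetS _ BR) dR.
apply: leq_trans (_ : #|B :|: tau o0 @: B| <= _)%N.
  by rewrite cardsU dB cards0 subn0 (card_in_imset tinj) (@leq_add 4 4).
apply/subset_leq_card; rewrite subUset; apply/andP; split; apply/subsetP => o.
  by move=> oB; rewrite inE Bh ?Bz.
case/imsetP=> o' oB ->; apply/setIP; split.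
  by case: (tauP o0h (Bh _ oB)).
exact: (symm_zeros o0h xyS (Bh _ oB) (Bz _ oB)).
Qed.

End Extension.

(** Outside the five points there are q^2 - q - 4 zeros of [h], each on one of the q + 1 members of
    the pencil. From q = 5 on this exceeds 2(q + 1), so some member gains three zeros. *)
Lemma many_zeros5 h : (5 <= q)%N -> #|zeros h| = (q ^ 2 - q + 1)%N ->
  exists f, [/\ f \in U1, f \notin line h & (8 <= #|zeros h :&: zeros f|)%N].
Proof.
move=> q5 ch.
have Q5 : (5 * q <= q ^ 2)%N by rewrite -mulnn leq_mul2r q5 orbT.
have [|B Bh cB] := @subset_of_card _ (zeros h) 5; first by rewrite ch; lia.
pose A := pt @: B.
have AU : A \subset U1 by apply/subsetP => _ /imsetP[o _ ->]; exact: pt_in.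
have cA : (#|A| <= 5)%N by rewrite -[5%N in leqRHS]cB leq_imset_card.
have cann : (q ^ 3 <= #|ann A|)%N.
  have := leq_card_ann AU => le8.
  rewrite -(leq_pmul2l (m := (q ^ 5)%N)) ?expn_gt0 ?q_gt0 // -expnD.
  by apply: leq_trans le8 _; rewrite leq_mul2r leq_exp2l ?cA ?orbT //; lia.
have q13 : (q < q ^ 3)%N by rewrite -{1}(expn1 q) ltn_exp2l //; lia.
have q23 : (q ^ 2 < q ^ 3)%N by rewrite ltn_exp2l //; lia.
have [f2 f2A f2h] : exists2 f2, f2 \in ann A & f2 \notin line h.
  by apply: notin_leq; apply: leq_ltn_trans (card_line h) _; apply: leq_trans cann.
have [f1 f1A f1h] : exists2 f1, f1 \in ann A & f1 \notin addline (line h) f2.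
  apply: notin_leq; apply: leq_ltn_trans (leq_imset_card _ _) _.
  rewrite cardsX card_Fq; apply: leq_trans cann; apply: leq_ltn_trans q23.
  by rewrite -mulnn leq_mul2r card_line orbT.
have /annP[f1U f1z] := f1A; have /annP[f2U f2z] := f2A.
have Bz f o : f \in ann A -> o \in B -> o \in zeros f.
  by move=> /annP[_ fz] oB; rewrite inE fz // imset_f.
(* [g o] names a member through [o]: [None] stands for [f2] and [Some k] for [f1 + k *: f2]. *)
pose g o : option F := if dot f2 (pt o) == 0 then None
  else Some (- (dot f1 (pt o) / dot f2 (pt o))).
have [|| b b3] := @pigeonhole3 _ _ (zeros h :\: B) (None |: [set Some k | k in Fq]) g.
- move=> o _; rewrite /g; case: eqP => _; first exact: setU11.
  by rewrite setU1r // imset_f // FqN ?FqM ?FqV ?dot_Fq ?pt_in.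
- rewrite cardsD (setIidPr Bh) cB ch cardsU1.
  have -> : None \in [set Some k | k in Fq] = false by apply/imsetP => -[].
  rewrite card_imset; last by move=> ? ? [].
  by rewrite card_Fq /=; nia.
have H8 f : f \in ann A -> [set o in zeros h :\: B | g o == b] \subset zeros f ->
    (8 <= #|zeros h :&: zeros f|)%N.
  move=> fA fb; set C := [set o in _ | _] in b3 fb.
  have dBC : B :&: C = set0.
    by apply/setP => o; rewrite !inE; case: (o \in B); rewrite ?andbF.
  apply: leq_trans (_ : #|B :|: C| <= _)%N.
    by rewrite cardsU dBC cards0 subn0 cB (leq_add (leqnn 5) b3).
  apply/subset_leq_card; rewrite subUset !subsetI Bh fb andbT /=.
  apply/andP; split; first by apply/subsetP => o; apply: Bz.
  by apply/subsetP => o; rewrite /C in_set => /andP[/setDP[]].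
case: b b3 H8 => [k|] b3 H8; last first.
  exists f2; split=> //; apply: H8 => //; apply/subsetP => o.
  by rewrite in_set /g [o \in zeros f2]in_set => /andP[_]; case: (_ == 0).
have kq : k \in Fq.
  have /card_gt0P[o] := leq_trans (isT : 0 < 3)%N b3; rewrite in_set /g => /andP[_].
  by case: ifPn => // _ /eqP[<-]; rewrite FqN ?FqM ?FqV ?dot_Fq ?pt_in.
exists (f1 - (- k) *: f2); split.
- by rewrite U1B ?U1Z ?FqN.
- apply: contra f1h => fh; apply/imsetP; exists (f1 - (- k) *: f2, - k).
    by rewrite inE /= fh FqN.
  by rewrite /= subrK.
apply: H8.
  apply: annB => //; apply/annP; split; first by rewrite U1Z ?FqN.
  by move=> v vA; rewrite dotZl f2z ?mulr0.
apply/subsetP => o; rewrite in_set /g => /andP[_]; case: ifPn => // f20 /eqP[<-].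
by rewrite inE dotBl dotZl opprK divfK // subrr.
Qed.

(** * Choice of theta in an algebraic closure *)

Lemma section_facts h : h \in U1 -> h != 0 -> #|zeros h| = (q ^ 2 - q + 1)%N ->
  [/\ forall phi psi (T : {set option F}), phi \in U1 -> psi \in U1 ->
        T \subset zeros h -> T \subset zeros phi -> T \subset zeros psi ->
        (6 < #|T|)%N -> psi \in line h \/ phi \in addline (line h) psi,
      forall phi, phi \in U1 -> zeros h \subset zeros phi -> phi \in line h
    & exists f, [/\ f \in U1, f \notin line h & (8 <= #|zeros h :&: zeros f|)%N]].
Proof.
move=> hU h0 ch.
have noroot x : pivot (co h) x != 0.
  by apply: contra_eq_neq ch => hx; apply: zeros_pivot hx.
have lc : co h 4 * co h 7 != co h 5 * co h 6.
  by apply: contra_eq_neq ch; apply: zeros_pivot_infty.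
have [L [iota _]] := countable_algebraic_closure F.
pose k0 := co h 0 * co h 3 - co h 2 * co h 1.
pose k1 := co h 0 * co h 7 + co h 4 * co h 3 - co h 2 * co h 5 - co h 6 * co h 1.
pose k2 := co h 4 * co h 7 - co h 5 * co h 6.
have k20 : iota k2 != 0 by rewrite fmorph_eq0 subr_eq0.
have pivE x : pivot (ico iota h) x = iota k0 + iota k1 * x + iota k2 * x ^+ 2.
  by rewrite /pivot /ico /k0 /k1 /k2 !(rmorphB, rmorphD, rmorphM); ring.
pose p : {poly L} := Poly [:: iota k0; iota k1; iota k2].
have [|th0 /eqP] := closed_rootP p _.
  have : p`_2 != 0 by rewrite coef_Poly.
  by apply: contraTneq => sz; rewrite nth_default ?eqxx // sz.
rewrite horner_Poly /= => Q0.
have {}Q0 : pivot (ico iota h) th0 = 0 by rewrite pivE -[RHS]Q0; ring.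
have fr3 x : iota x ^+ q ^+ q ^+ q = iota x by rewrite -!rmorphXn /= frob3.
pose th1 := th0 ^+ q; pose th2 := th1 ^+ q; pose th3 := th2 ^+ q.
pose th4 := th3 ^+ q; pose th5 := th4 ^+ q.
have fD := frobDL iota.
have Q3 : pivot (ico iota h) th3 = 0.
  have := congr1 (fun x => x ^+ q ^+ q ^+ q) Q0; rewrite !pivE.
  rewrite !(fD, exprMn) !fr3 !zero_frobL //.
have th30 : th3 != th0.
  apply/eqP => e; have [t tE] := frob3_im iota e.
  have := noroot t; rewrite -(fmorph_eq0 iota).
  by move/eqP: Q0; rewrite tE /pivot /ico !(rmorphB, rmorphD, rmorphM) => ->.
(* The q^3-power map fixes the sum of the two roots and sends [th0] to [th3], so it sends [th3] back
   to [th0]. *)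
have s03 : iota k1 + iota k2 * (th0 + th3) = 0.
  have d0 : th3 - th0 != 0 by rewrite subr_eq0.
  apply: (mulIf d0); rewrite mul0r; move: Q0 Q3; rewrite !pivE => Q0 Q3.
  by transitivity (0 - 0 : L); [rewrite -{1}Q3 -Q0; ring | rewrite subr0].
have th50 : th5 ^+ q = th0.
  have := congr1 (fun x => x ^+ q ^+ q ^+ q) s03.
  rewrite !(fD, exprMn) !fr3 !zero_frobL // -/th1 -/th2 -/th3 -/th4 -/th5 -[RHS]s03.
  by move/addrI/(mulfI k20); rewrite addrC => /addIr.
have lcL : ico iota h 4 * ico iota h 7 != ico iota h 5 * ico iota h 6.
  by rewrite /ico -!rmorphM (inj_eq (fmorph_inj iota)).
have hb : b0 iota th0 th1 th2 th3 th4 th5 h = 0 by apply: pivot_root_b0.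
split.
- move=> phi psi T pU pU' Th Tp Tp' T7.
  have [[k kq ->]|[k [l [kq lq ->]]]] :=
    common_zeros erefl erefl erefl erefl erefl th50 th30 hU h0 hb pU pU' Th Tp Tp' T7.
    by left; apply/imsetP; exists k.
  right; apply/imsetP; exists (l *: h, k); last by rewrite addrC.
  by rewrite inE /= kq andbT; apply/imsetP; exists l.
- move=> phi pU hp.
  have [k kq ->] := zeros_h_sub erefl erefl erefl erefl erefl th50 th30 hU h0 hb pU ch hp.
  by apply/imsetP; exists k.
have [q5|q4] := leqP 5 q; first exact: many_zeros5.
have {}q4 : q = 4%N by apply/eqP; rewrite eqn_leq q_ge4 -ltnS q4.
apply: (many_zeros4 erefl erefl erefl erefl erefl th50 th30 hU h0 hb q4).
by rewrite ch q4.
Qed.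

(** * The three conditions for projective subspaces *)

(** The map [P] from [option F] onto [O1] is injective: the coordinates 0, 4 and 7 separate the
    points. *)
Lemma card_pts_in S : subspace S ->
  #|pts_in F (O1 F q) S| = #|[set o | pt o \in S]|.
Proof.
case=> _ _ _ SZ; pose P o : {set 'rV[F]_8} := [set k *: pt o | k in Fq].
have ptP o : pt o \in P o by apply/imsetP; exists 1; rewrite ?Fq1 ?scale1r.
have Pinj : injective P.
  move=> o o' PP; have := ptP o; rewrite PP => /imsetP[k kq ptk].
  have c i : co (pt o) i = k * co (pt o') i by rewrite ptk coZ.
  case: o {PP} ptk c => [t|]; case: o' => [t'|] //= _ c; have := c 0; have := c 4;
    rewrite !co_vecU //= ?mulr1 ?mulr0.
  - by move=> -> <-; rewrite mul1r.
  - by move=> _ /eqP; rewrite oner_eq0.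
  - by move=> _ k0; have := c 7; rewrite !co_vecU //= -k0 mul0r => /eqP; rewrite oner_eq0.
rewrite -(card_imset _ Pinj); apply: eq_card => A; rewrite in_set; apply/andP/imsetP.
  case=> AO AS; have [o Ao] : exists o, A = P o.
    by case/setUP: AO => [/imsetP[t _ ->]|/set1P->]; [exists (Some t) | exists None].
  by exists o; rewrite // inE; apply: (subsetP AS); rewrite Ao.
case=> o; rewrite inE => oS ->; split.
  by apply/setUP; case: o {oS} => [t|]; [left; apply: imset_f | right; apply: set11].
by apply/subsetP => _ /imsetP[k kq ->]; apply: SZ.
Qed.

Lemma pts_in_sub (S H : {set 'rV[F]_8}) : S \subset H ->
  pts_in F (pts_in F (O1 F q) H) S = pts_in F (O1 F q) S.
Proof.
move=> SH; apply/setP => P; rewrite !in_set -andbA; congr (_ && _).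
by apply/andP/idP => [[]//|PS]; rewrite PS (subset_trans PS SH).
Qed.

Lemma kernel_subspace W f : subspace W ->
  subspace [set v in W | dot f v == 0].
Proof.
case=> WU W0 WD WZ; split.
- by apply: subset_trans WU; apply/subsetP => v; rewrite in_set => /andP[].
- by rewrite in_set W0 dot0r eqxx.
- move=> x y; rewrite !in_set => /andP[xW /eqP xf] /andP[yW /eqP yf].
  by rewrite WD // dotDr xf yf addr0 eqxx.
- move=> k x kq; rewrite !in_set => /andP[xW /eqP xf].
  by rewrite WZ // dotZr xf mulr0 eqxx.
Qed.

Lemma span_subspace (A : {set 'rV[F]_8}) : A \subset U1 -> subspace (Defs.span F q A).
Proof.
move=> AU; have [_ U0 UD UZ] := U1_subspace; split.
- apply: bigcap_inf; rewrite subxx U0 AU !andbT /=; apply/andP; split.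
    by apply/forallP => x; apply/forallP => y; apply/implyP => xU; apply/implyP => yU; exact: UD.
  by apply/forallP => k; apply/forallP => x; apply/implyP => kq; apply/implyP => xU; exact: UZ.
- by apply/bigcapP => W /and5P[].
- move=> x y /bigcapP xA /bigcapP yA; apply/bigcapP => W WP.
  have /and5P[_ _ /forallP/(_ x)/forallP/(_ y) WD _ _] := WP.
  by move: WD; rewrite xA // yA.
move=> k x kq /bigcapP xA; apply/bigcapP => W WP.
have /and5P[_ _ _ /forallP/(_ k)/forallP/(_ x) WZ _] := WP.
by move: WZ; rewrite kq xA.
Qed.

Lemma span_min (A W : {set 'rV[F]_8}) : subspace W -> A \subset W -> Defs.span F q A \subset W.
Proof.
case=> WU W0 WD WZ AW; apply: bigcap_inf; rewrite WU W0 AW !andbT /=; apply/andP; split.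
  by apply/forallP => x; apply/forallP => y; apply/implyP => xU; apply/implyP => yU; exact: WD.
by apply/forallP => k; apply/forallP => x; apply/implyP => kq; apply/implyP => xU; exact: WZ.
Qed.

Lemma sub_span (A : {set 'rV[F]_8}) : A \subset Defs.span F q A.
Proof. by apply/bigcapsP => W /and5P[]. Qed.

Lemma hyperplane_section_64 H : proj_subspace F q H 6 ->
  #|pts_in F (O1 F q) H| = (q ^ 2 - q + 1)%N ->
  rs_set_of F q H (pts_in F (O1 F q) H) 6 4.
Proof.
case=> sH cH cX; have [HU H0 HD HZ] := sH.
have q1 : (1 < q)%N by lia.
have [h hH hn0] : exists2 h, h \in ann H & h \notin [set 0].
  apply: notin_leq; rewrite cards1; apply: leq_trans q1 _; rewrite -[leqLHS]expn1.
  by apply: (@card_ann_subspace _ 7); rewrite ?cH.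
have {hn0} h0 : h != 0 by move: hn0; rewrite inE.
have /annP[hU hz] := hH.
have HK : H \subset [set v in U1 | dot h v == 0].
  apply/subsetP => v vH; rewrite in_set; apply/andP; split; last by rewrite hz ?eqxx.
  exact: (subsetP HU).
(* If the kernel of [h] were larger than [H], adjoining one vector would already give q^8 elements,
   so [h] would vanish on [U1] and be zero by [pt_nondeg]. *)
have Hker : H = [set v in U1 | dot h v == 0].
  apply/eqP; rewrite eqEsubset HK /=.
  apply/negPn/negP => /subsetPn[x]; rewrite in_set => /andP[xU /eqP xh] xH.
  have sW := kernel_subspace h U1_subspace.
  have HW : addline H x \subset [set v in U1 | dot h v == 0].
    by apply: addline_sub sW HK _; rewrite in_set xU xh eqxx.
  have WU : [set v in U1 | dot h v == 0] \subset U1 by case: sW.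
  have /eqP WE : [set v in U1 | dot h v == 0] == U1.
    by rewrite eqEcard WU card_U1 (leq_trans _ (subset_leq_card HW)) // card_addline // cH -expnSr.
  case/eqP: h0; apply: pt_nondeg => // o; have := pt_in o.
  by rewrite -WE in_set => /andP[_ /eqP].
have ptH o : (pt o \in H) = (o \in zeros h) by rewrite Hker in_set [RHS]in_set pt_in.
have cz : #|zeros h| = (q ^ 2 - q + 1)%N.
  by rewrite -cX card_pts_in //; apply: eq_card => o; rewrite [RHS]in_set ptH.
have [facts1 facts2 [f [fU fh f8]]] := section_facts hU h0 cz.
have q23 : (q ^ 2 < q ^ 3)%N by rewrite ltn_exp2l.
have q13 : (q < q ^ 3)%N by rewrite -{1}(expn1 q) ltn_exp2l.
split.
- move=> S [sS cS] SH; rewrite pts_in_sub // card_pts_in // leqNgt; apply/negP => T7.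
  (* [S] has vector dimension 5, so [ann S] is large enough to contain two functionals independent
     modulo [h]. *)
  have cann : (q ^ 3 <= #|ann S|)%N by apply: (@card_ann_subspace _ 5); rewrite ?cS.
  have [psi psiS psih] : exists2 psi, psi \in ann S & psi \notin line h.
    by apply: notin_leq; apply: leq_ltn_trans (card_line h) _; apply: leq_trans cann.
  have [phi phiS phih] : exists2 phi, phi \in ann S & phi \notin addline (line h) psi.
    apply: notin_leq; apply: leq_ltn_trans (leq_imset_card _ _) _.
    rewrite cardsX card_Fq; apply: leq_trans cann; apply: leq_ltn_trans q23.
    by rewrite -mulnn leq_mul2r card_line orbT.
  have /annP[psiU psiz] := psiS; have /annP[phiU phiz] := phiS.
  have TS g : (forall v, v \in S -> dot g v = 0) -> [set o | pt o \in S] \subset zeros g.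
    by move=> gz; apply/subsetP => o; rewrite !in_set => /gz->.
  have Th : [set o | pt o \in S] \subset zeros h by apply: TS => v /(subsetP SH)/hz.
  case: (facts1 phi psi _ phiU psiU Th (TS _ phiz) (TS _ psiz) T7).
    by rewrite (negPf psih).
  by rewrite (negPf phih).
- set A := \bigcup_(P in _) P.
  have ptA o : o \in zeros h -> pt o \in A.
    rewrite -ptH => oH; apply/bigcupP; exists [set k *: pt o | k in Fq].
      rewrite in_set; apply/andP; split; last by apply/subsetP => _ /imsetP[k kq ->]; apply: HZ.
      by apply/setUP; case: (o) => [t|]; [left; apply: imset_f | right; apply: set11].
    by apply/imsetP; exists 1; rewrite ?Fq1 ?scale1r.
  have AH : A \subset H by apply/bigcupsP => P; rewrite in_set => /andP[].
  have sW := span_subspace (subset_trans AH HU).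
  (* A proper span has at most q^6 elements, so some [g] outside [line h] annihilates it, against
     [facts2]. *)
  apply/eqP; rewrite eqEcard span_min //= leqNgt; apply/negP => ltW.
  have [k [cW _]] := subspace_gen sW.
  have cann : (q ^ 2 <= #|ann (Defs.span F q A)|)%N.
    apply: (@card_ann_subspace _ 6) => //; move: ltW; rewrite cW cH.
    by rewrite ltn_exp2l // leq_exp2l // ltnS.
  have [g gW gh] : exists2 g, g \in ann (Defs.span F q A) & g \notin line h.
    apply: notin_leq; apply: leq_ltn_trans (card_line h) _; apply: leq_trans cann.
    by rewrite -{1}(expn1 q) ltn_exp2l.
  have /annP[gU gz] := gW; case/negP: gh; apply: facts2 => //.
  by apply/subsetP => o oh; rewrite in_set gz // (subsetP (sub_span A)) ?ptA.
(* The kernel of [f] in [H] has vector dimension 6, that is projective dimension 5, and contains at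
   least eight of the points. *)
pose S := [set v in H | dot f v == 0].
have sS : subspace S by apply: kernel_subspace.
have SH : S \subset H by apply/subsetP => v; rewrite in_set => /andP[].
exists S; split=> //.
- split=> //; apply/eqP; rewrite eqn_leq; apply/andP; split.
    have [SE|neS] := eqVneq S H.
      case/negP: fh; apply: facts2 => //; apply/subsetP => o; rewrite -ptH -SE !in_set.
      by case/andP.
    have /properP[_ [x xH xS]] : S \proper H by rewrite properEneq neS.
    have := subset_leq_card (addline_sub sH SH xH).
    by rewrite card_addline // cH expnSr leq_pmul2r // ltnW.
  have : (#|H| <= size (enum Fq) * #|S|)%N.
    apply: (leq_card_additive (g := dot f)) => [x y|x y _ _|x xH].
    + exact: subspaceB.
    + exact: dotBr.
    + by rewrite mem_enum; apply: dot_Fq => //; apply: (subsetP HU).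
  by rewrite -cardE card_Fq cH expnS leq_pmul2l // ltnW.
rewrite pts_in_sub // card_pts_in //; apply: leq_trans f8 _.
apply/subset_leq_card/subsetP => o /setIP[oh of_]; rewrite !in_set ptH oh /=.
by move: of_; rewrite in_set.
Qed.

End FiniteField.

Theorem mainTheorem11 (F : finFieldType) (q : nat)
  (hF : #|F| = (q ^ 3)%N) (hq : (4 <= q)%N)
  (H : {set 'rV[F]_8}) (hH : proj_subspace F q H 6)
  (hcard : #|pts_in F (O1 F q) H| = (q ^ 2 - q + 1)%N) :
  rs_set_of F q H (pts_in F (O1 F q) H) 6 4.
Proof. exact: hyperplane_section_64. Qed.
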